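(* Let $N \ge 1$ be an integer and consider the system $$-\Delta u = v^p, \qquad -\Delta v = u^\theta \qquad \text{in } \mathbb{R}^N. \tag{S}$$ 1. Suppose $2 \le p \le \theta$ and $$N < 2 + \frac{4(\theta+1)}{p\theta-1}\, t_0^+ .$$ Then there is no positive stable solution $(u,v)$ of (S). In particular, if $N \le 10$, there is no positive stable solution of (S) for any $2 \le p \le \theta$. 2. Suppose $1 < p \le \theta$, $2 t_0^- < p$ and $$N < 2 + \frac{4(\theta+1)}{p\theta-1}\, t_0^+ .$$ Then there is no positive stable solution $(u,v)$ of (S).
   Context: For $1 \le p \le \theta$ put $z = \frac{p\theta(p+1)}{\theta+1}$ and define $$t_0^- = \sqrt{z} - \sqrt{z - \sqrt{z}}, \qquad t_0^+ = \sqrt{z} + \sqrt{z-\sqrt{z}} .$$ A positive solution of (S) is a pair $(u,v)$ of smooth functions on $\mathbb{R}^N$ with $u>0$, $v>0$ everywhere, satisfying the equations pointwise. Such a solution is called stable if there exist smooth functions $\zeta>0$ and $\chi>0$ on $\mathbb{R}^N$ with $$-\Delta \zeta = p\, v^{p-1}\chi, \qquad -\Delta \chi = \theta\, u^{\theta-1}\zeta \qquad \text{in } \mathbb{R}^N.$$ *)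

(* Defs.v *)
From mathcomp Require Import all_boot all_order all_algebra.
From mathcomp Require Import all_classical all_reals all_analysis.

Set Implicit Arguments.
Unset Strict Implicit.
Unset Printing Implicit Defensive.

Import Order.TTheory GRing.Theory Num.Theory.
Import numFieldNormedType.Exports.

Local Open Scope classical_set_scope.
Local Open Scope ring_scope.

(* R^N is 'rV[R]_N; its canonical norm is the sup norm, which only matters here
   through the topology it induces. *)

Definition partial (R : realType) (N : nat) (i : 'I_N) (f : 'rV[R]_N -> R) :
    'rV[R]_N -> R :=
  fun x => 'D_(delta_mx 0 i) f x.

(* 'D_v is total, so an equation on [laplacian] is only meaningful together with
   [smooth]. *)
Definition laplacian (R : realType) (N : nat) (f : 'rV[R]_N -> R) :
    'rV[R]_N -> R :=
  fun x => \sum_(i < N) partial i (partial i f) x.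

(* C^oo: the partial derivatives of every order, taken in any order (the list
   [s] of indices, [::] giving f itself), exist and are continuous. *)
Definition smooth (R : realType) (N : nat) (f : 'rV[R]_N -> R) : Prop :=
  forall s : seq 'I_N,
    continuous (foldr (@partial R N) f s) /\
    forall (i : 'I_N) (x : 'rV[R]_N),
      derivable (foldr (@partial R N) f s) x (delta_mx 0 i).

Definition positive_solution (R : realType) (N : nat) (p theta : R)
    (u v : 'rV[R]_N -> R) : Prop :=
  [/\ smooth u /\ smooth v,
      forall x, 0 < u x,
      forall x, 0 < v x,
      forall x, - laplacian u x = v x `^ p
    & forall x, - laplacian v x = u x `^ theta].

Definition stable (R : realType) (N : nat) (p theta : R)
    (u v : 'rV[R]_N -> R) : Prop :=
  exists zeta chi : 'rV[R]_N -> R,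
  [/\ smooth zeta /\ smooth chi,
      forall x, 0 < zeta x,
      forall x, 0 < chi x,
      forall x, - laplacian zeta x = p * v x `^ (p - 1) * chi x
    & forall x, - laplacian chi x = theta * u x `^ (theta - 1) * zeta x].

Definition zpar (R : realType) (p theta : R) : R :=
  p * theta * (p + 1) / (theta + 1).

Definition t0_minus (R : realType) (p theta : R) : R :=
  let z := zpar p theta in Num.sqrt z - Num.sqrt (z - Num.sqrt z).

Definition t0_plus (R : realType) (p theta : R) : R :=
  let z := zpar p theta in Num.sqrt z + Num.sqrt (z - Num.sqrt z).

(* Main.v *)
Require Import Defs.
From mathcomp Require Import all_boot all_order all_algebra.
From mathcomp Require Import all_classical all_reals all_analysis.
From mathcomp Require Import ring lra zify.

Set Implicit Arguments.
Unset Strict Implicit.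
Unset Printing Implicit Defensive.

Import Order.TTheory GRing.Theory Num.Theory.
Import numFieldNormedType.Exports.

Local Open Scope classical_set_scope.
Local Open Scope ring_scope.

(** Why there is no stable positive solution.

    Put b = 2 (theta + 1) / (p theta - 1) and a = 2 (p + 1) / (p theta - 1).
    The system and its linearisation are invariant under
    u -> L^a u (x0 + L x), v -> L^b v (x0 + L x).  Suppose that some moment
    of v, the mean of v^beta against a fixed cutoff, is bounded by a constant
    that is the same for all stable solutions.  Applied to the rescaled
    solutions, the bound forces the integral of v^beta over the ball of radius L
    to be at most C L^(N - b beta), which is absurd for large L as soon as
    b beta > N ([blowup]).  With gain = 2 / b, the hypothesis on N says exactly
    that b beta > N for some beta < 2 t0_plus + gain, so all moments below that
    exponent have to be bounded uniformly:

    - Testing the two equations with powers of a cutoff bounds the moment of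
      exponent p ([a_priori]).
    - kappa u <= v^sigma pointwise, with sigma = (p + 1) / (theta + 1)
      ([comparison]).  The difference w = kappa u - v^sigma satisfies
      Delta w >= kappa w^(1 + epsilon) where it is positive.  As for the
      Keller-Osserman equation, this bounds the moments of the positive part of w
      of all large exponents, and the rescaling argument makes it vanish.
    - Stability gives a Hardy-type inequality with weight
      sqrt (p theta) u^((theta - 1) / 2) v^((p - 1) / 2)
      ([stability_inequality]).  For the test function v^t phi, the comparison
      bounds the left-hand side below by the integral of
      sqrt z u^theta v^(2 t - 1) phi^2, while the equation for v turns
      the gradient term on the right into t^2 / (2 t - 1) times the same
      integral.  If sqrt z (2 t - 1) > t^2, that is if t lies between t0_minus
      and t0_plus, the moment of exponent 2 t controls both
      u^theta v^(2 t - 1) and |grad v|^2 v^(2 t - 2) ([energy_estimate]).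
    - Integrating v^p v^(2 t - sigma) phi^2 = (- Delta u) v^(2 t - sigma) phi^2
      by parts until no derivative of u is left, every term is controlled by the
      comparison and the energy estimate.  Hence the moment of exponent 2 t
      bounds the one of exponent 2 t + gain ([gain_step]); this replaces the
      Sobolev inequality or elliptic regularity as the source of integrability.

    Since 2 t0_minus < p, the last step can start at the exponent p, and
    iterating it reaches every exponent below 2 t0_plus + gain ([bootstrap],
    [liouville]).  For p >= 2 the condition 2 t0_minus < p holds because
    t0_minus < 1, and t0_plus > 2 gain ([t0_plus_gt]) makes the bound on N
    larger than 10.

    No integral is needed.  Functions are averaged over finer and finer grids of
    the cube [-1, 1)^N.  These means are exactly linear and monotone, and
    the means of a partial derivative of a C^1 function that vanishes on the boundary
    tend to 0 ([grid_mean_partial_small]).  All estimates being scale-free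
    inequalities with absolute constants, an integration by parts that is
    wrong by at most 1 on all fine grids serves as well as an exact one,
    so limits of the means are never taken. *)

(** * Differentiation along coordinate directions *)

Section Continuity.
Variables (R : realType) (T : topologicalType).
Implicit Types f g : T -> R.

Lemma continuousM_fun f g : continuous f -> continuous g -> continuous (fun x => f x * g x).
Proof. by move=> cf cg x; apply: cvgM; [exact: cf|exact: cg]. Qed.

Lemma continuousD_fun f g : continuous f -> continuous g -> continuous (fun x => f x + g x).
Proof. by move=> cf cg x; apply: cvgD; [exact: cf|exact: cg]. Qed.

Lemma continuous_cst_fun (c : R) : continuous (fun _ : T => c).
Proof. by move=> x; exact: cvg_cst. Qed.

Lemma continuous_powR f a : (forall x, 0 < f x) -> continuous f ->
  continuous (fun x => f x `^ a).
Proof.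
move=> f0 cf x; apply: (@continuous_comp _ _ _ f (fun y : R => y `^ a)); first exact: cf.
have [/derivable1_diffP/differentiable_continuous + _] := is_derive1_powR a (f0 x).
exact.
Qed.

End Continuity.

Section Derivatives.
Variables (R : realType) (N : nat).
Implicit Types (f g : 'rV[R]_N -> R) (i : 'I_N) (x v : 'rV[R]_N).

(** Reduces directional derivatives to one-variable calculus on lines, where the
    chain rule and the mean value theorem are available. *)
Lemma is_derive_lineE f x v s d :
  is_derive (s *: v + x) v f d <-> is_derive s (1 : R) (fun h : R => f (h *: v + x)) d.
Proof.
have E : (fun h : R => h^-1 *: (((fun h : R => f (h *: v + x)) \o shift s) (h *: (1 : R)) -
            (fun h : R => f (h *: v + x)) s)) =
         (fun h : R => h^-1 *: ((f \o shift (s *: v + x)) (h *: v) - f (s *: v + x))).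
  apply/funext => h /=; congr (_ *: (f _ - _)).
  by rewrite scalerDl addrA /GRing.scale/= mulr1.
split=> -[ex <-].
  by split; rewrite /derivable /derive E.
by split; [rewrite /derivable -E|rewrite /derive -E].
Qed.

Lemma is_derive_chain f (h : R -> R) x v d dh :
  is_derive x v f d -> is_derive (f x) 1 h dh -> is_derive x v (h \o f) (dh * d).
Proof.
move=> fd hd; have -> : x = 0 *: v + x by rewrite scale0r add0r.
apply/is_derive_lineE.
have -> : (fun s : R => (h \o f) (s *: v + x)) = h \o (fun s : R => f (s *: v + x)) by [].
apply: is_derive1_comp; first by rewrite scale0r add0r.
by apply/is_derive_lineE; rewrite scale0r add0r.
Qed.

Definition C1_along i f := [/\ continuous f, continuous (partial i f) &
  forall x, derivable f x (delta_mx 0 i)].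

Lemma C1_along_is_derive i f : C1_along i f ->
  forall x, is_derive x (delta_mx 0 i) f (partial i f x).
Proof. by move=> [_ _ df] x; exact: derivableP. Qed.

Lemma C1_along_intro i f df : continuous f -> continuous df ->
  (forall x, is_derive x (delta_mx 0 i) f (df x)) ->
  C1_along i f /\ partial i f = df.
Proof.
move=> cf cdf fd; have E : partial i f = df.
  by apply/funext => x; rewrite /partial; case: (fd x).
by split=> //; split=> //; rewrite ?E// => x; case: (fd x).
Qed.

Lemma C1_along_partialM i f g : C1_along i f -> C1_along i g -> C1_along i (fun x => f x * g x) /\
  partial i (fun x => f x * g x) = (fun x => f x * partial i g x + g x * partial i f x).
Proof.
move=> Df Dg; case: (Df) (Dg) => [cf cdf _] [cg cdg _]; apply: C1_along_intro.
- exact: continuousM_fun.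
- by apply: continuousD_fun; exact: continuousM_fun.
- by move=> x; have := C1_along_is_derive Df x; have := C1_along_is_derive Dg x => dg df;
    exact: is_deriveM.
Qed.

Lemma C1_along_partialD i f g : C1_along i f -> C1_along i g -> C1_along i (fun x => f x + g x) /\
  partial i (fun x => f x + g x) = (fun x => partial i f x + partial i g x).
Proof.
move=> Df Dg; case: (Df) (Dg) => [cf cdf _] [cg cdg _]; apply: C1_along_intro.
- exact: continuousD_fun.
- exact: continuousD_fun.
- by move=> x; have := C1_along_is_derive Df x; have := C1_along_is_derive Dg x => dg df;
    exact: is_deriveD.
Qed.

Lemma C1_along_partial_cst i (c : R) : C1_along i (fun _ : 'rV[R]_N => c) /\
  partial i (fun _ : 'rV[R]_N => c) = (fun=> 0).
Proof.
by apply: C1_along_intro; exact: continuous_cst_fun.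
Qed.

Lemma C1_along_partial_comp i f (h dh : R -> R) : C1_along i f ->
  (forall x, is_derive (f x) 1 h (dh (f x))) ->
  continuous (fun x => dh (f x)) ->
  C1_along i (fun x => h (f x)) /\
  partial i (fun x => h (f x)) = (fun x => dh (f x) * partial i f x).
Proof.
move=> Df hd cdh; case: (Df) => [cf cdf _]; apply: C1_along_intro.
- move=> x; apply: (@continuous_comp _ _ _ f h); first exact: cf.
  have [/derivable1_diffP/differentiable_continuous + _] := hd x; exact.
- exact: continuousM_fun.
- by move=> x; apply: (is_derive_chain (C1_along_is_derive Df x) (hd x)).
Qed.

Lemma C1_along_partial_powR i f (a : R) : (forall x, 0 < f x) -> C1_along i f ->
  C1_along i (fun x => f x `^ a) /\
  partial i (fun x => f x `^ a) = (fun x => a * f x `^ (a - 1) * partial i f x).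
Proof.
move=> f0 Df; apply: (@C1_along_partial_comp i f (fun y => y `^ a) (fun y => a * y `^ (a - 1)))
  => //.
  by move=> x; exact: is_derive1_powR.
apply: continuousM_fun; first exact: continuous_cst_fun.
by apply: continuous_powR => //; case: Df.
Qed.

Definition C1 f := forall i, C1_along i f.
(** Only the pure second derivatives are required: they are all that the
    Laplacian and the divergence theorem for grad f * g involve. *)
Definition C2 f := forall i, C1_along i f /\ C1_along i (partial i f).

Lemma C2_C1 f : C2 f -> C1 f. Proof. by move=> H i; case: (H i). Qed.

Definition grad_dot f g x := \sum_(i < N) partial i f x * partial i g x.

Lemma C1M f g : C1 f -> C1 g -> C1 (fun x => f x * g x).
Proof. by move=> Cf Cg i; have [] := C1_along_partialM (Cf i) (Cg i). Qed.

Lemma C1D f g : C1 f -> C1 g -> C1 (fun x => f x + g x).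
Proof. by move=> Cf Cg i; have [] := C1_along_partialD (Cf i) (Cg i). Qed.

Lemma C1_cst (c : R) : C1 (fun=> c).
Proof. by move=> i; have [] := C1_along_partial_cst i c. Qed.

Lemma C1_powR f a : (forall x, 0 < f x) -> C1 f -> C1 (fun x => f x `^ a).
Proof. by move=> f0 Cf i; have [] := C1_along_partial_powR a f0 (Cf i). Qed.

Lemma grad_dotC f g : grad_dot f g = grad_dot g f.
Proof. by apply/funext => x; apply: eq_bigr => i _; rewrite mulrC. Qed.

Lemma grad_dotMr f g h x : C1 g -> C1 h ->
  grad_dot f (fun x => g x * h x) x = g x * grad_dot f h x + h x * grad_dot f g x.
Proof.
move=> Cg Ch; rewrite /grad_dot !mulr_sumr -big_split/=; apply: eq_bigr => i _.
by have [_ ->] := C1_along_partialM (Cg i) (Ch i); ring.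
Qed.

Lemma grad_dotDr f g h x : C1 g -> C1 h ->
  grad_dot f (fun x => g x + h x) x = grad_dot f g x + grad_dot f h x.
Proof.
move=> Cg Ch; rewrite /grad_dot -big_split/=; apply: eq_bigr => i _.
by have [_ ->] := C1_along_partialD (Cg i) (Ch i); ring.
Qed.

Lemma grad_dot_cst f c x : grad_dot f (fun=> c) x = 0.
Proof.
rewrite /grad_dot big1// => i _.
by have [_ ->] := C1_along_partial_cst i c; rewrite mulr0.
Qed.

Lemma grad_dot_powR f g a x : (forall x, 0 < g x) -> C1 g ->
  grad_dot f (fun x => g x `^ a) x = a * g x `^ (a - 1) * grad_dot f g x.
Proof.
move=> g0 Cg; rewrite /grad_dot mulr_sumr; apply: eq_bigr => i _.
by have [_ ->] := C1_along_partial_powR a g0 (Cg i); ring.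
Qed.

(** The squared norm of a grad f + b grad g, expanded.  All uses of the
    Cauchy-Schwarz and Young inequalities for gradients below are instances. *)
Lemma grad_dot_sqr_ge0 f g (a b : R) x :
  0 <= a ^+ 2 * grad_dot f f x + 2 * a * b * grad_dot f g x + b ^+ 2 * grad_dot g g x.
Proof.
rewrite /grad_dot !mulr_sumr -!big_split/=; apply: sumr_ge0 => i _.
set p := partial i f x; set q := partial i g x.
have -> : a ^+ 2 * (p * p) + 2 * a * b * (p * q) + b ^+ 2 * (q * q) =
  (a * p + b * q) ^+ 2 by ring.
exact: sqr_ge0.
Qed.

End Derivatives.

(** * Grid means and integration by parts *)

Section Grid.
Variables (R : realType) (N : nat).
Implicit Types (f g : 'rV[R]_N -> R) (i : 'I_N) (x v : 'rV[R]_N).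

Definition cube : set 'rV[R]_N := [set x | forall i, x 0 i \in `[-1, 1]].

(** The grid is half-open in every coordinate, so that adding 1 in the cyclic
    group of indices is the translation by one step, up to the identification
    of opposite faces of the cube. *)
Definition grid_point m (k : {ffun 'I_N -> 'I_m.+1}) : 'rV[R]_N :=
  \row_i (2 * (k i)%:R / m.+1%:R - 1).

Definition grid_mean m f : R :=
  (m.+1%:R ^+ N)^-1 * \sum_(k : {ffun 'I_N -> 'I_m.+1}) f (grid_point k).

Lemma grid_meanD m f g : grid_mean m (fun x => f x + g x) = grid_mean m f + grid_mean m g.
Proof. by rewrite /grid_mean big_split/= mulrDr. Qed.

Lemma grid_meanZ m c f : grid_mean m (fun x => c * f x) = c * grid_mean m f.
Proof. by rewrite /grid_mean -mulr_sumr mulrCA. Qed.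

Lemma grid_mean_sum m (F : 'I_N -> 'rV[R]_N -> R) :
  grid_mean m (fun x => \sum_i F i x) = \sum_i grid_mean m (F i).
Proof. by rewrite /grid_mean exchange_big/= mulr_sumr. Qed.

Lemma grid_cube m (k : {ffun 'I_N -> 'I_m.+1}) : cube (grid_point k).
Proof.
move=> i; rewrite mxE in_itv/=; have km := ltn_ord (k i).
have k0 : 0 <= (k i)%:R / m.+1%:R :> R by rewrite divr_ge0.
have k1 : (k i)%:R / m.+1%:R <= 1 :> R.
  by rewrite ler_pdivrMr ?ltr0n// mul1r ler_nat ltnW.
by rewrite -mulrA; move: (_ / _) k0 k1 => t k0 k1; lra.
Qed.

Lemma grid_mean_le_cube m f g : (forall x, cube x -> f x <= g x) -> grid_mean m f <= grid_mean m g.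
Proof.
move=> fg; rewrite /grid_mean ler_wpM2l ?invr_ge0 ?exprn_ge0//.
by apply: ler_sum => k _; exact/fg/grid_cube.
Qed.

Lemma grid_mean_le m f g : (forall x, f x <= g x) -> grid_mean m f <= grid_mean m g.
Proof. by move=> fg; exact: grid_mean_le_cube. Qed.

Lemma grid_mean_cst m c : grid_mean m (fun=> c) = c.
Proof.
rewrite /grid_mean sumr_const card_ffun !card_ord -[c *+ _]mulr_natl natrX mulKf//.
Qed.

Lemma grid_mean_norm_le m f (e : R) : (forall x, cube x -> `|f x| <= e) ->
  `|grid_mean m f| <= e.
Proof.
move=> fe; rewrite ler_norml; apply/andP; split.
  rewrite -[leLHS](grid_mean_cst m); apply: grid_mean_le_cube => x /fe.
  by rewrite ler_norml => /andP[].
rewrite -[leRHS](grid_mean_cst m); apply: grid_mean_le_cube => x /fe.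
by rewrite ler_norml => /andP[].
Qed.

Lemma cube_compact : compact cube.
Proof.
have := @rV_compact _ N (fun=> (`[-1, 1]%classic : set R)) (fun=> @segment_compact _ _ _).
by congr compact; apply/seteqP; split=> x xc i; have := xc i.
Qed.

(** Heine on the compact cube; the displaced point may leave the cube, since
    f is continuous everywhere. *)
Lemma unif_cont_cube f v (e : R) : continuous f -> 0 < e ->
  exists2 d : R, 0 < d & forall s x, `|s| < d -> cube x ->
    `|f (s *: v + x) - f x| <= e.
Proof.
move=> cf e0.
have cF (x : 'rV[R]_N) :
    (fun z : 'rV[R]_N * R => f (z.2 *: v + z.1) - f z.1) z @[z --> (x, 0 : R)] --> (0 : R).
  have E : (0 : R) = f ((0:R) *: v + x) - f x by rewrite scale0r add0r subrr.
  rewrite {2}E; apply: cvgB.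
    apply: (@continuous_comp _ _ _ (fun z : 'rV[R]_N * R => z.2 *: v + z.1) f (x, 0));
      last exact: cf.
    apply: (@cvgD _ _ _ _ _ (fun z : 'rV[R]_N * R => z.2 *: v) (fun z => z.1)).
      by apply: cvgZr_tmp; exact: cvg_snd.
    exact: cvg_fst.
  by apply: (@continuous_comp _ _ _ (fun z : 'rV[R]_N * R => z.1) f (x, 0));
    [exact: cvg_fst|exact: cf].
have /compact_near_coveringP := cube_compact.
move=> /(_ R (nbhs (0 : R)) (fun s x => `|f (s *: v + x) - f x| <= e) _).
case.
  move=> x _; have /cvgrPdist_le/(_ e e0) := cF x.
  by apply: filterS => -[x' s]/=; rewrite sub0r normrN.
move=> d/= d0 H; exists d => // s x sd xc; apply: H => //=.
by rewrite sub0r normrN.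
Qed.


Definition vanishes_off_cube f := forall x i, 1 <= `|x 0 i| -> f x = 0.

(** The shift by one grid step is a permutation of the cyclic indices, except
    that it moves the last layer out of the cube instead of wrapping it around.
    There both values of f are 0. *)
Lemma grid_mean_shift m i f : vanishes_off_cube f ->
  grid_mean m (fun x => f ((2 / m.+1%:R) *: 'e_i + x)) = grid_mean m f.
Proof.
move=> f0; rewrite /grid_mean; congr (_ * _).
pose d : {ffun 'I_N -> 'I_m.+1} := [ffun j => if j == i then inZp 1 else 0].
rewrite [RHS](reindex_inj (addrI d))/=; apply: eq_bigr => k _.
have m0 : m.+1%:R != 0 :> R by rewrite pnatr_eq0.
have dj j : j != i -> (d + k) j = k j by move=> ji; rewrite !ffunE (negbTE ji) add0r.
have di : nat_of_ord ((d + k) i) = ((k i).+1 %% m.+1)%N.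
  by rewrite !ffunE eqxx /= modnDml add1n.
have [kim|kim] := ltnP (k i) m.
  congr f; apply/rowP => j; rewrite !mxE/= ; have [->|ji] := eqVneq j i.
    by rewrite di modn_small ?ltnS// mulr1n -[(k i).+1%:R]natr1; move: (m.+1%:R) => M; ring.
  by rewrite mulr0 add0r dj.
have {}kim : (k i : nat) = m by apply/eqP; rewrite eqn_leq kim -ltnS ltn_ord.
rewrite (f0 _ i); last first.
  rewrite !mxE/= eqxx kim mulr1 (_ : _ + (_ - 1) = 1) ?normr1//.
  by move: m0; rewrite -natr1 => m0; field; exact: m0.
rewrite (f0 _ i)// mxE di kim modnn mulr0 mul0r sub0r normrN normr1//.
Qed.

(** The difference quotients of f with the grid step have mean exactly 0 by
    [grid_mean_shift], and by the mean value theorem they differ from the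
    partial derivative by no more than its modulus of continuity. *)
Lemma grid_mean_partial_small i f : C1_along i f -> vanishes_off_cube f -> forall e, 0 < e ->
  \forall m \near \oo, `|grid_mean m (partial i f)| <= e.
Proof.
move=> Df f0 e e0; have [cf cdf _] := Df.
have [d d0 dP] := unif_cont_cube 'e_i cdf e0.
have d2 : 0 < d / 2 by rewrite divr_gt0.
near=> m; set h : R := 2 / m.+1%:R.
have h0 : 0 < h by rewrite divr_gt0// ltr0n.
have hd : h < d.
  have : m.+1%:R^-1 < d / 2 by near: m; exact: near_infty_natSinv_lt (PosNum d2).
  by rewrite /h; move: (m.+1%:R^-1) => t; lra.
have -> : grid_mean m (partial i f) =
    grid_mean m (fun x => partial i f x + (- h^-1) * (f (h *: 'e_i + x) + (-1) * f x)).
  by rewrite grid_meanD grid_meanZ grid_meanD grid_meanZ grid_mean_shift// mulN1r subrr mulr0 addr0.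
apply: grid_mean_norm_le => x xc.
have lineD (s : R) :
    is_derive s 1 (fun s : R => f (s *: 'e_i + x)) (partial i f (s *: 'e_i + x)).
  by apply/is_derive_lineE; exact: C1_along_is_derive.
have [|c] := @MVT R (fun s => f (s *: 'e_i + x)) _ _ _ h0 (fun s _ => lineD s).
  apply: continuous_subspaceT => s.
  by have [/derivable1_diffP/differentiable_continuous + _] := lineD s; exact.
rewrite in_itv/= => /andP[c0 ch]; rewrite scale0r add0r subr0 mulN1r => ->.
rewrite mulNr mulrC mulfK ?gt_eqF// distrC; apply: dP => //.
by rewrite gtr0_norm// (lt_trans ch).
Unshelve. all: by end_near. Qed.

End Grid.

Section Green.
Variables (R : realType) (N : nat).
Implicit Types (f g : 'rV[R]_N -> R) (i : 'I_N) (x v : 'rV[R]_N).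

(** Green's first identity up to a small error: the function averaged is the
    divergence of g grad f. *)
Lemma green f g : C2 f -> C1 g ->
  (forall i, vanishes_off_cube (fun x => partial i f x * g x)) ->
  \forall m \near \oo, `|grid_mean m (fun x => laplacian f x * g x + grad_dot f g x)| <= 1.
Proof.
move=> Cf Cg fg0.
have e0 : 0 < N.+1%:R^-1 :> R by rewrite invr_gt0 ltr0n.
have : \forall m \near \oo, forall i,
    `|grid_mean m (partial i (fun x => partial i f x * g x))| <= N.+1%:R^-1.
  apply: filter_forall => i.
  have [_ Dfi] := Cf i.
  exact: (grid_mean_partial_small (C1_along_partialM Dfi (Cg i)).1 (fg0 i) e0).
apply: filterS => m H.
rewrite (_ : (fun x => _) =
    (fun x => \sum_i partial i (fun x => partial i f x * g x) x)); last first.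
  apply/funext => x; rewrite /laplacian /grad_dot mulr_suml -big_split/=.
  apply: eq_bigr => i _; have [_ Dfi] := Cf i.
  by have [_ ->] := C1_along_partialM Dfi (Cg i); ring.
rewrite grid_mean_sum (le_trans (ler_norm_sum _ _ _))//.
rewrite (le_trans (ler_sum _ (fun i _ => H i)))// sumr_const card_ord.
by rewrite -[X in X <= _]mulr_natl ler_pdivrMr ?ltr0n// mul1r ler_nat.
Qed.

(** The grid puts at least a fraction (r / 4)^N of its points in the cube of
    half-side r, once it is fine enough; r / 4 instead of r absorbs the
    rounding. *)
Lemma grid_mean_ge_small f (c r : R) : 0 <= c -> 0 < r <= 1 -> (forall x, 0 <= f x) ->
  (forall x, (forall i, `|x 0 i| <= r) -> c <= f x) ->
  \forall m \near \oo, c * (r / 4) ^+ N <= grid_mean m f.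
Proof.
move=> c0 /andP[r0 r1] f0 fc.
have r4 : 0 < r / 4 by rewrite divr_gt0.
near=> m.
have hm : m.+1%:R^-1 < r / 4 by near: m; exact: near_infty_natSinv_lt (PosNum r4).
set M : R := m.+1%:R.
have M0 : 0 < M by rewrite ltr0n.
have Mr : 4 <= M * r.
  by move: hm; rewrite -/M invf_plt ?posrE// => /ltW; rewrite invf_div ler_pdivrMr.
pose q := Num.truncn (M * r / 2).
have qP : q%:R <= M * r / 2 < q.+1%:R.
  by apply: truncn_itv; rewrite divr_ge0// mulr_ge0// ltW.
(* the indices whose coordinate is at most r in absolute value; the q
   indices from the middle of the grid upwards are among them *)
pose A : {set 'I_m.+1} := [set j : 'I_m.+1 | `|2 * j%:R / M - 1| <= r]%SET.
have qA : (q <= #|A|)%N.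
  have sM (s : 'I_q) : (m.+1./2 + s < m.+1)%N.
    rewrite -(ltr_nat R) natrD -/M.
    have s1 : s.+1%:R <= q%:R :> R by rewrite ler_nat.
    have : (m.+1./2)%:R * 2 <= M :> R.
      by rewrite -natrM ler_nat muln2 -{2}[m.+1]odd_double_half leq_addl.
    have : M * r <= M by rewrite ler_piMr// ltW.
    by rewrite -natr1 in s1; move: qP => /andP[]; lra.
  have inj : injective (fun s : 'I_q => Ordinal (sM s)).
    by move=> s t /(congr1 val)/= /addnI/val_inj.
  rewrite -[q in (q <= _)%N]card_ord -(card_imset _ inj); apply: subset_leq_card.
  apply/fintype.subsetP => _ /imsetP[s _ ->]; rewrite inE/= natrD.
  have s1 : s.+1%:R <= q%:R :> R by rewrite ler_nat.
  have h1 : (m.+1./2)%:R * 2 <= M :> R.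
    by rewrite -natrM ler_nat muln2 -{2}[m.+1]odd_double_half leq_addl.
  have h2 : M <= (m.+1./2)%:R * 2 + 1 :> R.
    by rewrite -natrM natr1 ler_nat; clear; lia.
  rewrite -(ler_pM2l M0) -{1}(gtr0_norm M0) -normrM mulrBr mulr1.
  rewrite mulrCA divff ?gt_eqF// mulr1.
  rewrite -natr1 in s1; move: qP => /andP[q1 _]; have s0 : 0 <= s%:R :> R by [].
  by rewrite ler_norml; apply/andP; split; lra.
have rq : r / 4 * M <= q%:R.
  by move: qP => /andP[_]; rewrite -[q.+1%:R]natr1; move: (q%:R) => Q; clearbody M; lra.
rewrite /grid_mean ler_pdivlMl ?exprn_gt0//.
apply: (@le_trans _ _ (\sum_(k in ffun_on A) f (@grid_point R N m k))); last first.
  by rewrite [leRHS](bigID (mem (ffun_on A)))/= lerDl sumr_ge0.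
apply: (@le_trans _ _ (\sum_(k : {ffun 'I_N -> 'I_m.+1} | k \in ffun_on A) c)); last first.
  apply: ler_sum => k /ffun_onP kA; apply: fc => i.
  by have := kA i; rewrite inE mxE.
rewrite sumr_const card_ffun_on card_ord -[leRHS]mulr_natl mulrCA [leLHS]mulrC.
rewrite ler_wpM2r// -exprMn (le_trans (_ : _ <= q%:R ^+ N))//.
  rewrite mulrC in rq; apply: lerXn2r rq; rewrite ?nnegrE//.
  by rewrite mulr_ge0 ?ltW.
by rewrite natrX; apply: lerXn2r; rewrite ?nnegrE// ler_nat.
Unshelve. all: by end_near. Qed.

End Green.

(** * The cutoff functions *)

Section PositivePart.
Variable R : realType.
Implicit Types t : R.

Definition pos_part t := Num.max t 0.

Lemma pos_part_ge0 t : 0 <= pos_part t.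
Proof. by rewrite /pos_part le_max lexx orbT. Qed.

Lemma pos_part_id t : 0 <= t -> pos_part t = t.
Proof. by move=> t0; rewrite /pos_part max_l. Qed.

Lemma pos_part_eq0 t : t <= 0 -> pos_part t = 0.
Proof. by move=> t0; rewrite /pos_part max_r. Qed.

Lemma continuous_pos_part (T : topologicalType) (f : T -> R) :
  continuous f -> continuous (fun x => pos_part (f x)).
Proof.
by move=> cf x; apply: (@continuous_max R T f (fun=> 0)); [exact: cf|exact: cvg_cst].
Qed.

Lemma continuous_exp (T : topologicalType) (f : T -> R) n :
  continuous f -> continuous (fun x => f x ^+ n).
Proof.
move=> cf; elim: n => [|n IHn]; first exact: continuous_cst_fun.
rewrite (_ : (fun x => _) = (fun x => f x * f x ^+ n)); first exact: continuousM_fun.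
by apply/funext => x; rewrite exprS.
Qed.

Lemma is_derive_pos_partX n t :
  is_derive t 1 (fun s => pos_part s ^+ n.+2) (n.+2%:R * pos_part t ^+ n.+1).
Proof.
have [t0|t0|->] := ltgtP t 0.
- rewrite pos_part_eq0 ?ltW// expr0n mulr0.
  apply: (@near_eq_is_derive _ _ _ (fun=> 0)).
  near=> s; rewrite pos_part_eq0 ?expr0n//.
  by apply/ltW; near: s; exact: lt_nbhsl.
- rewrite pos_part_id ?ltW//.
  apply: (@near_eq_is_derive _ _ _ (fun s : R => s ^+ n.+2)).
    near=> s; rewrite pos_part_id//.
    by apply/ltW; near: s; exact: lt_nbhsr.
  by split; [exact: exprn_derivable|rewrite exp_derive [LHS]mulr1].
- rewrite pos_part_eq0// expr0n mulr0.
  suff H : h^-1 *: (pos_part (h *: 1 + 0) ^+ n.+2 - pos_part 0 ^+ n.+2) @[h --> 0^'] --> (0 : R).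
    by split; [apply/cvg_ex; exists 0|exact: cvg_lim].
  apply/cvgrPdist_le => e e0; near=> h.
  rewrite (pos_part_eq0 (lexx _)) expr0n subr0 sub0r normrN addr0 /GRing.scale/= mulr1.
  have [h0|h0] := leP h 0.
    by rewrite pos_part_eq0// expr0n mulr0 normr0 ltW.
  have h0' := ltW h0.
  rewrite pos_part_id// exprS mulKf ?gt_eqF// ger0_norm ?exprn_ge0//.
  have h1 : `|h| <= 1 by near: h; apply: dnbhs0_le.
  have he : `|h| <= e by near: h; apply: dnbhs0_le.
  move: h1 he; rewrite gtr0_norm// => h1 he.
  by rewrite exprS (le_trans _ he)// ler_piMr ?exprn_ile1.
Unshelve. all: by end_near. Qed.

End PositivePart.

Section CutOff.
Variables (R : realType) (N : nat).
Implicit Types (f g : 'rV[R]_N -> R) (i : 'I_N) (x v : 'rV[R]_N).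

Lemma C1_along_partial_pos_partX i f n : C1_along i f ->
  C1_along i (fun x => pos_part (f x) ^+ n.+2) /\
  partial i (fun x => pos_part (f x) ^+ n.+2) =
    (fun x => n.+2%:R * pos_part (f x) ^+ n.+1 * partial i f x).
Proof.
move=> Df; apply: (@C1_along_partial_comp _ _ _ _ (fun t => pos_part t ^+ n.+2)
  (fun t => n.+2%:R * pos_part t ^+ n.+1)) => //.
  by move=> x; exact: is_derive_pos_partX.
apply: continuousM_fun; first exact: continuous_cst_fun.
by apply/continuous_exp/continuous_pos_part; case: Df.
Qed.

Lemma C1_pos_partX f n : C1 f -> C1 (fun x => pos_part (f x) ^+ n.+2).
Proof. by move=> Cf i; have [] := C1_along_partial_pos_partX n (Cf i). Qed.

Lemma grad_dot_pos_partX f g n x : C1 g ->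
  grad_dot f (fun x => pos_part (g x) ^+ n.+2) x =
  n.+2%:R * pos_part (g x) ^+ n.+1 * grad_dot f g x.
Proof.
move=> Cg; rewrite /grad_dot mulr_sumr; apply: eq_bigr => i _.
by have [_ ->] := C1_along_partial_pos_partX n (Cg i); ring.
Qed.

(** Positive exactly on the open unit ball, so that the powers of its positive
    part are cutoffs whose regularity improves with the exponent and whose
    gradient is controlled by the previous power. *)
Definition paraboloid x : R := 1 - \sum_i x 0 i ^+ 2.

Lemma C1_along_partial_coord i j : C1_along i (fun x : 'rV[R]_N => x 0 j) /\
  partial i (fun x : 'rV[R]_N => x 0 j) = (fun=> (j == i)%:R).
Proof.
apply: C1_along_intro; [exact: coord_continuous|exact: continuous_cst_fun|move=> x].
rewrite -[x in is_derive x _]add0r -(scale0r ('e_i : 'rV[R]_N)).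
apply/is_derive_lineE.
rewrite (_ : (fun h : R => _) = (fun h : R => h * (j == i)%:R) \+ cst (x 0 j)).
  have H : is_derive (0 : R) 1 (fun h : R => h * (j == i)%:R) (j == i)%:R.
    have := is_deriveM (is_derive_id (0 : R) 1) (is_derive_cst ((j == i)%:R : R) (0 : R) 1).
    by rewrite scaler0 add0r /GRing.scale/= mulr1.
  have := is_deriveD H (is_derive_cst (x 0 j) (0 : R) 1).
  by rewrite addr0.
by apply/funext => h; rewrite !mxE eqxx.
Qed.

Lemma C1_along_partial_paraboloid i : C1_along i paraboloid /\
  partial i paraboloid = (fun x => - 2 * x 0 i).
Proof.
have H (s : seq 'I_N) : C1_along i (fun x => \sum_(j <- s) x 0 j ^+ 2) /\
  partial i (fun x => \sum_(j <- s) x 0 j ^+ 2) =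
    (fun x => \sum_(j <- s) 2 * (j == i)%:R * x 0 j).
  elim: s => [|j s [IH IHE]].
    rewrite (_ : (fun x : 'rV_N => _) = fun=> 0); last first.
      by apply/funext => x; rewrite big_nil.
    have [H ->] := C1_along_partial_cst i (0 : R); split=> //.
    by apply/funext => x; rewrite big_nil.
  have [Dj jE] := C1_along_partial_coord i j; have [Djj jjE] := C1_along_partialM Dj Dj.
  have [H HE] := C1_along_partialD Djj IH.
  rewrite (_ : (fun x : 'rV_N => _) = (fun x : 'rV_N => x 0 j * x 0 j + \sum_(j <- s) x 0 j ^+ 2)).
    split=> //; rewrite HE jjE IHE jE; apply/funext => x; rewrite big_cons; ring.
  by apply/funext => x; rewrite big_cons expr2.
have [Ds sE] := H (index_enum 'I_N).
have [D2 E2] := C1_along_partialM (C1_along_partial_cst i (-1)).1 Ds.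
have [D3 E3] := C1_along_partialD (C1_along_partial_cst i 1).1 D2.
rewrite (_ : paraboloid = (fun x => 1 + -1 * \sum_j x 0 j ^+ 2)).
  split=> //; rewrite E3 E2 sE !(C1_along_partial_cst i _).2; apply/funext => x.
  rewrite add0r mulr0 addr0 (bigD1 i)//= eqxx mulr1n big1 => [|j ji]; first by ring.
  by rewrite (negbTE ji) mulr0 mul0r.
by apply/funext => x; rewrite /paraboloid mulN1r.
Qed.

Definition cutoff K x : R := pos_part (paraboloid x) ^+ K.

Lemma cutoff_ge0 K x : 0 <= cutoff K x.
Proof. exact/exprn_ge0/pos_part_ge0. Qed.

Lemma paraboloid_le1 x : paraboloid x <= 1.
Proof. by rewrite /paraboloid lerBlDr lerDl sumr_ge0// => i _; exact: sqr_ge0. Qed.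

Lemma pos_paraboloid_le1 x : pos_part (paraboloid x) <= 1.
Proof. by rewrite /pos_part ge_max paraboloid_le1/=. Qed.

Lemma cutoff_le K K' x : (K' <= K)%N -> cutoff K x <= cutoff K' x.
Proof.
move=> KK'; rewrite /cutoff ler_wiXn2l ?pos_part_ge0//.
exact: pos_paraboloid_le1.
Qed.

Lemma cutoff_le1 K x : cutoff K x <= 1.
Proof. by rewrite (le_trans (cutoff_le x (leq0n K)))// /cutoff expr0. Qed.

Lemma cutoffM K K' x : cutoff K x * cutoff K' x = cutoff (K + K') x.
Proof. by rewrite /cutoff exprD. Qed.

Lemma cutoffS K x : cutoff K.+1 x = cutoff K x * pos_part (paraboloid x).
Proof. exact: exprSr. Qed.

Lemma cutoff_vanishes K : vanishes_off_cube (cutoff K.+1).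
Proof.
move=> x i xi; rewrite /cutoff pos_part_eq0 ?expr0n// /paraboloid subr_le0.
rewrite (bigD1 i)//= (le_trans (_ : 1 <= x 0 i ^+ 2))//.
  by rewrite -real_normK ?num_real// expr_ge1.
by rewrite lerDl sumr_ge0// => j _; exact: sqr_ge0.
Qed.

Lemma C1_paraboloid : C1 paraboloid.
Proof. by move=> i; have [] := C1_along_partial_paraboloid i. Qed.

Lemma C1_cutoff K : C1 (cutoff K.+2).
Proof. exact/C1_pos_partX/C1_paraboloid. Qed.

Lemma grad_dot_cutoff f K x :
  grad_dot f (cutoff K.+2) x = K.+2%:R * cutoff K.+1 x * grad_dot f paraboloid x.
Proof. exact/grad_dot_pos_partX/C1_paraboloid. Qed.

Lemma vanishes_mull f g : vanishes_off_cube f -> vanishes_off_cube (fun x => f x * g x).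
Proof. by move=> f0 x i xi; rewrite (f0 x i xi) mul0r. Qed.

Lemma vanishes_mulr f g : vanishes_off_cube g -> vanishes_off_cube (fun x => f x * g x).
Proof. by move=> g0 x i xi; rewrite (g0 x i xi) mulr0. Qed.

Lemma partial_cutoff_vanishes K i : vanishes_off_cube (partial i (cutoff K.+2)).
Proof.
rewrite /cutoff (C1_along_partial_pos_partX K (C1_along_partial_paraboloid i).1).2.
by apply/vanishes_mull/vanishes_mulr/cutoff_vanishes.
Qed.

Lemma cutoff_sum_le K x : cutoff K.+1 x * (\sum_i x 0 i ^+ 2) <= cutoff K.+1 x.
Proof.
have [p0|p0] := ltP 0 (paraboloid x); last first.
  by rewrite /cutoff pos_part_eq0// expr0n mul0r.
rewrite ler_piMr ?cutoff_ge0//.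
by move: p0; rewrite /paraboloid subr_gt0 => /ltW.
Qed.

(** On the support of the cutoff |x| <= 1, and |grad paraboloid|^2 = 4 |x|^2. *)
Lemma cutoff_dot_le K x :
  cutoff K.+1 x * grad_dot paraboloid paraboloid x <= 4 * cutoff K.+1 x.
Proof.
rewrite (_ : grad_dot _ _ _ = 4 * \sum_i x 0 i ^+ 2).
  by rewrite mulrCA ler_pM2l// cutoff_sum_le.
rewrite /grad_dot mulr_sumr; apply: eq_bigr => i _.
by rewrite (C1_along_partial_paraboloid i).2; ring.
Qed.

Lemma grad_dot_ge0 f x : 0 <= grad_dot f f x.
Proof. by apply: sumr_ge0 => i _; exact: sqr_ge0. Qed.

Lemma C1_along_partial2_cutoff K i : C1_along i (cutoff K.+3) /\
  C1_along i (partial i (cutoff K.+3)) /\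
  partial i (partial i (cutoff K.+3)) = (fun x =>
    K.+3%:R * (4 * K.+2%:R * cutoff K.+1 x * x 0 i ^+ 2 - 2 * cutoff K.+2 x)).
Proof.
have Dp := C1_along_partial_paraboloid i.
have [D3 E3] := C1_along_partial_pos_partX K.+1 Dp.1.
have [D2 E2] := C1_along_partial_pos_partX K Dp.1.
split; first exact: D3.
have [Dx Ex] := C1_along_partialM (C1_along_partial_cst i (K.+3%:R * -2)).1
  (C1_along_partial_coord i i).1.
have [Dxx Exx] := C1_along_partialM D2 Dx.
have -> : partial i (cutoff K.+3) =
  (fun x => pos_part (paraboloid x) ^+ K.+2 * (K.+3%:R * -2 * x 0 i)).
  by rewrite /cutoff E3 Dp.2; apply/funext => x; ring.
split=> //; rewrite Exx Ex E2 Dp.2 (C1_along_partial_cst i _).2 (C1_along_partial_coord i i).2.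
by apply/funext => x; rewrite eqxx mulr1n /cutoff; ring.
Qed.

Lemma C2_cutoff K : C2 (cutoff K.+3).
Proof. by move=> i; have [? []] := C1_along_partial2_cutoff K i. Qed.

(** Two derivatives cost two powers.  This is what allows one family of nested
    cutoffs to replace nested balls. *)
Lemma laplacian_cutoff_le K x :
  `|laplacian (cutoff K.+3) x| <= K.+3%:R * (4 * K.+2%:R + 2 * N%:R) * cutoff K.+1 x.
Proof.
have -> : laplacian (cutoff K.+3) x = K.+3%:R * (4 * K.+2%:R *
    (cutoff K.+1 x * \sum_i x 0 i ^+ 2) - 2 * N%:R * cutoff K.+2 x).
  rewrite /laplacian (eq_bigr
    (fun i => K.+3%:R * (4 * K.+2%:R * cutoff K.+1 x * x 0 i ^+ 2 - 2 * cutoff K.+2 x))).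
    rewrite -mulr_sumr sumrB -mulr_sumr sumr_const card_ord -[_ *+ N]mulr_natl.
    by congr (_ * _); ring.
  by move=> i _; have [_ [_ ->]] := C1_along_partial2_cutoff K i.
rewrite normrM ger0_norm// -[leRHS]mulrA ler_wpM2l//.
have a0 : 0 <= cutoff K.+1 x * \sum_i x 0 i ^+ 2.
  by rewrite mulr_ge0 ?cutoff_ge0// sumr_ge0// => i _; exact: sqr_ge0.
have ac := cutoff_sum_le K x; have bc := cutoff_le x (leqnSn K.+1).
have b0 := cutoff_ge0 K.+2 x.
set a := _ * \sum_i _ in a0 ac *; set b := cutoff K.+2 x in bc b0 *.
set c := cutoff K.+1 x in ac bc *.
have k0 : 0 <= K.+2%:R :> R by [].
have n0 : 0 <= N%:R :> R by [].
have h1 := ler_wpM2l k0 ac; have h2 := ler_wpM2l n0 bc.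
have h3 := mulr_ge0 k0 a0; have h4 := mulr_ge0 n0 b0.
by rewrite ler_norml; apply/andP; split; lra.
Qed.

End CutOff.

(** * Rescaling *)

Lemma continuous_affine (R : realType) (V : normedModType R) (L : R) (x0 : V) :
  continuous (fun x : V => L *: x + x0).
Proof. by move=> x; apply: cvgD; [exact: scaler_continuous|exact: cvg_cst]. Qed.

Section Rescale.
Variables (R : realType) (N : nat).
Implicit Types (f g : 'rV[R]_N -> R) (i : 'I_N) (x v : 'rV[R]_N).

Definition rescale (c L : R) x0 f x : R := c * f (L *: x + x0).

Lemma C1_along_partial_rescale c L x0 f i : C1_along i f -> C1_along i (rescale c L x0 f) /\
  partial i (rescale c L x0 f) = rescale (c * L) L x0 (partial i f).
Proof.
move=> Df; have [cf cdf _] := Df.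
have cg (g : 'rV[R]_N -> R) d : continuous g -> continuous (rescale d L x0 g).
  move=> cg; apply: continuousM_fun; first exact: continuous_cst_fun.
  move=> x; apply: (@continuous_comp _ _ _ (fun x => L *: x + x0) g); last exact: cg.
  exact: continuous_affine.
apply: C1_along_intro; [exact: cg|exact: cg|move=> x].
rewrite -[x in is_derive x _]add0r -(scale0r ('e_i : 'rV[R]_N)).
apply/is_derive_lineE.
set x1 := L *: x + x0.
have H : is_derive (L * 0) 1 (fun s : R => f (s *: 'e_i + x1)) (partial i f x1).
  by rewrite mulr0; apply/is_derive_lineE; rewrite scale0r add0r; exact: C1_along_is_derive.
have HL : is_derive (0 : R) 1 (fun s : R => L * s) L.
  have := is_deriveM (is_derive_cst (L : R) (0 : R) 1) (is_derive_id (0 : R) 1).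
  by rewrite scaler0 addr0 /GRing.scale/= mulr1.
have := is_deriveM (is_derive_cst (c : R) (0 : R) 1) (is_derive1_comp H HL).
rewrite scaler0 addr0 /GRing.scale/= -/x1 /rescale -/x1 mulrA mulrAC => E.
rewrite (_ : (fun h => _) = (cst c * ((fun s : R => f (s *: 'e_i + x1)) \o [eta *%R L])))//.
by apply/funext => h; rewrite fctE/= scalerDr scalerA addrA.
Qed.

Lemma C2_rescale c L x0 f : C2 f -> C2 (rescale c L x0 f) /\
  laplacian (rescale c L x0 f) = rescale (c * L ^+ 2) L x0 (laplacian f).
Proof.
move=> Cf; split=> [i|].
  have [D DD] := Cf i; have [? E] := C1_along_partial_rescale c L x0 D.
  by rewrite E; split; [|exact: (C1_along_partial_rescale _ _ _ DD).1].
apply/funext => x; rewrite /laplacian /rescale mulr_sumr; apply: eq_bigr => i _.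
have [D DD] := Cf i.
by rewrite (C1_along_partial_rescale c L x0 D).2 (C1_along_partial_rescale _ _ _ DD).2 /rescale
  expr2 mulrA.
Qed.

Lemma smooth_C2 f : smooth f -> C2 f.
Proof.
move=> sf i; have [c0 d0] := sf [::]; have [c1 d1] := sf [:: i].
have [c2 d2] := sf [:: i; i].
by split; split; [exact: c0|exact: c1|exact: d0|exact: c1|exact: c2|exact: d1].
Qed.

End Rescale.

(** * Real powers and the interpolation inequality for cutoffs *)

Section RealPowers.
Variable R : realType.
Implicit Types x y a b : R.

Lemma powR_add x a b : 0 < x -> x `^ (a + b) = x `^ a * x `^ b.
Proof. by move=> x0; rewrite powRD// (gt_eqF x0) implybT. Qed.

Lemma powR_pred x a : 0 < x -> x `^ a = x `^ (a - 1) * x.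
Proof. by move=> x0; rewrite -{3}(powRr1 (ltW x0)) -powR_add// subrK. Qed.

Lemma ler_powR2r x y a : 0 <= a -> 0 <= x -> x <= y -> x `^ a <= y `^ a.
Proof.
move=> a0 x0 xy; apply: ge0_ler_powR => //; rewrite nnegrE//.
exact: le_trans xy.
Qed.

Lemma powR_le_add1 x a b : 0 < x -> a <= b -> 0 <= b -> 0 <= a -> x `^ a <= 1 + x `^ b.
Proof.
move=> x0 ab b0 a0; have [x1|x1] := leP 1 x.
  by rewrite (le_trans (ler_powR x1 ab))// lerDr.
apply: (@le_trans _ _ 1); last by rewrite lerDl powR_ge0.
have x01 : 0 < x <= 1 by rewrite x0 ltW.
by have := ger_powR x01 a0; rewrite powRr0.
Qed.

(** If e X^s r^2 >= 1 the first term on the right dominates.  Otherwise X^s is at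
    most 1 / (e r^2), and r^K with K s >= 2 compensates the blow-up as r tends
    to 0.  This absorbs a term with two powers of the cutoff less into one with
    a larger power of the unknown. *)
Lemma young_cut (s e : R) (K : nat) : 0 < s -> 0 < e -> 2 / s <= K%:R ->
  exists2 C, 0 <= C & forall X r, 0 <= X -> 0 <= r <= 1 ->
    X * r ^+ K <= e * (X `^ (1 + s) * r ^+ K.+2) + C.
Proof.
move=> s0 e0 Ks; exists (e^-1 `^ s^-1); first exact: powR_ge0.
move=> X r X0 /andP[r0 r1].
have rK0 := exprn_ge0 K r0.
have K0 : (0 < K)%N by rewrite -(ltr_nat R) (lt_le_trans _ Ks)// divr_gt0.
have XE : X `^ (1 + s) = X * X `^ s.
  by rewrite powRD ?powRr1// gt_eqF// addr_gt0.
have [h|h] := leP 1 (e * X `^ s * r ^+ 2).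
  apply: (@le_trans _ _ (X * r ^+ K * (e * X `^ s * r ^+ 2))).
    by rewrite ler_peMr// mulr_ge0.
  rewrite XE -(addn2 K) exprD.
  have -> : X * r ^+ K * (e * X `^ s * r ^+ 2) = e * (X * X `^ s * (r ^+ K * r ^+ 2)) by ring.
  by rewrite lerDl powR_ge0.
apply: (@le_trans _ _ (e^-1 `^ s^-1)); last first.
  rewrite lerDr; apply: mulr_ge0; first exact: ltW.
  by apply: mulr_ge0; [exact: powR_ge0|exact: exprn_ge0].
have Xr0 : 0 <= X * r ^+ K by rewrite mulr_ge0.
rewrite -[leLHS]powRr1// -(divff (lt0r_neq0 s0)) powRrM.
apply: ler_powR2r; [by rewrite invr_ge0 ltW|exact: powR_ge0|rewrite powRM//].
rewrite -[leRHS]mul1r ler_pdivlMr// mulrC mulrA.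
apply/ltW; apply: le_lt_trans h; apply: ler_wpM2l.
  by apply: mulr_ge0; [exact: ltW|exact: powR_ge0].
rewrite -!powR_mulrn// -powRrM.
have [r00|rn0] := eqVneq r 0.
  rewrite r00 powR0 ?powR_ge0// mulf_neq0 ?pnatr_eq0 -?lt0n// gt_eqF//.
apply: ger_powR; first by rewrite lt0r rn0 r0.
by rewrite -ler_pdivrMr.
Qed.

Lemma young_cutoff N (s e : R) (K : nat) : 0 < s -> 0 < e -> 2 / s <= K%:R ->
  exists2 C, 0 <= C & forall X (x : 'rV[R]_N), 0 <= X ->
    X * cutoff K x <= e * (X `^ (1 + s) * cutoff K.+2 x) + C.
Proof.
move=> s0 e0 Ks; have [C C0 H] := young_cut s0 e0 Ks; exists C => // X x X0.
by apply: H => //; rewrite pos_part_ge0 pos_paraboloid_le1.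
Qed.

End RealPowers.

(** * Uniform moment bounds contradict scaling *)

Section Blowup.
Variables (R : realType) (N : nat).
Implicit Types (f g : 'rV[R]_N -> R) (i : 'I_N) (x v : 'rV[R]_N).

(** Near x0 the function w is at least some c > 0.  The rescaled function is
    then at least L^a c on a cube of side of order 1 / L, which has volume of order
    L^(-N), and L^(a b - N) is unbounded. *)
Lemma blowup (w : 'rV[R]_N -> R) x0 (a b C : R) K :
  continuous w -> (forall x, 0 <= w x) -> 0 < w x0 ->
  0 <= b -> N%:R < a * b ->
  ~ (forall L, 1 <= L -> \forall m \near \oo,
      grid_mean m (fun x => rescale (L `^ a) L x0 w x `^ b * cutoff K x) <= C).
Proof.
move=> cw w0 wx0 b0 Nab H.
set c := w x0 / 2; have c0 : 0 < c by rewrite divr_gt0.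
have : \forall y \near x0, c <= w y.
  have /cvgrPdist_le/(_ c c0) := cw x0.
  by apply: filterS => y; rewrite ler_norml /c => /andP[]; lra.
move=> /nbhs_ballP[r1/= r10 r1P].
(* small enough for w >= c, and for |x|^2 <= 1/2 so that the cutoff is at
   least 2^-K *)
pose r := Num.min (r1 / 2) (2 * N.+1%:R)^-1.
have N0 : 0 < 2 * N.+1%:R :> R by rewrite mulr_gt0 ?ltr0n.
have r0 : 0 < r by rewrite lt_min divr_gt0//= invr_gt0.
have rr1 : r < r1.
  by apply: (@le_lt_trans _ _ (r1 / 2)); [rewrite /r ge_min lexx|lra].
have rN : r * (2 * N.+1%:R) <= 1.
  by rewrite -ler_pdivlMr// mul1r /r ge_min lexx orbT.
have r1' : r <= 1.
  have : 1 <= N.+1%:R :> R by rewrite ler1n.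
  by move: (N.+1%:R) rN => M; nra.
have bump_half x : (forall i, `|x 0 i| <= r) -> 2^-1 ^+ K <= cutoff K x.
  move=> xr; apply: lerXn2r; rewrite ?nnegrE ?pos_part_ge0//.
  rewrite /pos_part le_max; apply/orP; left; rewrite /paraboloid.
  suff : \sum_i x 0 i ^+ 2 <= 2^-1 by lra.
  apply: (@le_trans _ _ (\sum_(i < N) r)).
    apply: ler_sum => i _; rewrite -real_normK ?num_real// expr2.
    by rewrite (le_trans _ (xr i))// ler_piMr// (le_trans (xr i)).
  rewrite sumr_const card_ord -[leLHS]mulr_natr.
  have : N%:R <= N.+1%:R :> R by rewrite ler_nat.
  by move: (N.+1%:R) (N%:R) rN => M M' rM MM; nra.
set D := c `^ b * 2^-1 ^+ K * (r / 4) ^+ N.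
have D0 : 0 < D.
  by rewrite !mulr_gt0 ?powR_gt0 ?exprn_gt0 ?divr_gt0 ?invr_gt0.
have key L : 1 <= L -> D * L `^ (a * b - N%:R) <= C.
  move=> L1; have L0 : 0 < L by exact: lt_le_trans L1.
  have rL : 0 < r / L <= 1.
    by rewrite divr_gt0//= ler_pdivrMr// mul1r (le_trans r1').
  pose cc := (L `^ a * c) `^ b * 2^-1 ^+ K.
  have cc0 : 0 <= cc by rewrite mulr_ge0 ?powR_ge0 ?exprn_ge0.
  have := @grid_mean_ge_small R N
    (fun x => rescale (L `^ a) L x0 w x `^ b * cutoff K x) cc (r / L) cc0 rL.
  move=> /(_ _ _)/wrap[].
    by move=> x; rewrite mulr_ge0 ?powR_ge0 ?cutoff_ge0.
    move=> x xr; apply: ler_pM; rewrite ?powR_ge0 ?exprn_ge0//; last first.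
      apply: bump_half => i; rewrite (le_trans (xr i))// ler_pdivrMr// ler_peMr//.
      exact: ltW.
    apply: ler_powR2r; rewrite ?mulr_ge0 ?powR_ge0 ?(ltW c0)//.
    rewrite /rescale ler_wpM2l ?powR_ge0//; apply: r1P.
    split=> // k j; rewrite ord1 !mxE /ball/= opprD addrCA subrr addr0 normrN.
    rewrite normrM (gtr0_norm L0) mulrC; apply: le_lt_trans rr1.
    by rewrite -ler_pdivlMr.
  move=> H1; have H2 := H L L1.
  have [m [h1 h2]] : exists m, cc * (r / L / 4) ^+ N <=
     grid_mean m (fun x => rescale (L `^ a) L x0 w x `^ b * cutoff K x) /\
     grid_mean m (fun x => rescale (L `^ a) L x0 w x `^ b * cutoff K x) <= C.
    by apply: (@filter_ex _ \oo); near=> m; split; near: m.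
  apply: le_trans h2; apply: le_trans h1.
  rewrite le_eqVlt; apply/orP; left; apply/eqP.
  rewrite /D /cc powRM ?powR_ge0 ?(ltW c0)// -powRrM powRB; last first.
    by rewrite (gt_eqF L0) implybT.
  rewrite powR_mulrn ?(ltW L0)// !exprMn !exprVn; ring.
have g0 : 0 < a * b - N%:R by rewrite subr_gt0.
set g := a * b - N%:R in g0 key.
(* the scale at which D L^g reaches C + 1 *)
pose L := Num.max 1 (((C + 1) / D) `^ g^-1).
have L1 : 1 <= L by rewrite /L le_max lexx.
have := key L L1; apply/negP; rewrite -ltNge.
have C0 : 0 <= C.
  by have := key 1 (lexx _); rewrite powR1 mulr1; apply: le_trans; exact: ltW.
apply: (@lt_le_trans _ _ (C + 1)); first by rewrite ltrDl.
rewrite -ler_pdivrMl// mulrC.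
apply: (@le_trans _ _ ((((C + 1) / D) `^ g^-1) `^ g)).
  rewrite -powRrM mulVf ?gt_eqF// powRr1//.
  by apply: divr_ge0; [exact: addr_ge0|exact: ltW].
apply: ler_powR2r; [exact: ltW|exact: powR_ge0|].
by rewrite /L le_max lexx orbT.
Unshelve. all: by end_near. Qed.

End Blowup.

(** * The system, its scaling and the a priori bound *)

Section System.
Variables (R : realType) (N : nat).
Implicit Types (u v f g : 'rV[R]_N -> R) (i : 'I_N) (x : 'rV[R]_N) (p theta : R).
Local Opaque cutoff grid_mean grad_dot laplacian powR partial paraboloid.

Definition lane_emden p theta u v :=
  [/\ C2 u /\ C2 v, forall x, 0 < u x, forall x, 0 < v x,
    forall x, - laplacian u x = v x `^ p &
    forall x, - laplacian v x = u x `^ theta].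

(** Stability with the regularity that the proof uses, so that it is visibly
    preserved by [rescale]. *)
Definition linearly_stable p theta u v := exists zeta chi : 'rV[R]_N -> R,
  [/\ C2 zeta /\ C2 chi, forall x, 0 < zeta x, forall x, 0 < chi x,
    forall x, - laplacian zeta x = p * v x `^ (p - 1) * chi x &
    forall x, - laplacian chi x = theta * u x `^ (theta - 1) * zeta x].

(** The homogeneity exponents of the system: the solutions of
    scale_u + 2 = p scale_v and scale_v + 2 = theta scale_u. *)
Definition scale_u p theta : R := 2 * (p + 1) / (p * theta - 1).
Definition scale_v p theta : R := 2 * (theta + 1) / (p * theta - 1).

Lemma scale_uv p theta : 1 < p -> p <= theta ->
  scale_u p theta + 2 = scale_v p theta * p /\
  scale_v p theta + 2 = scale_u p theta * theta.
Proof.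
move=> p1 pt; have h : p * theta - 1 != 0 by rewrite gt_eqF// subr_gt0; nra.
by rewrite /scale_u /scale_v; split; field.
Qed.

Lemma rescale_gt0 c L x0 f : 0 < c -> (forall x, 0 < f x) ->
  forall x, 0 < rescale c L x0 f x.
Proof. by move=> c0 f0 x; rewrite mulr_gt0. Qed.

Lemma lane_emden_rescale p theta u v L x0 : 1 < p -> p <= theta -> 0 < L ->
  lane_emden p theta u v ->
  lane_emden p theta (rescale (L `^ scale_u p theta) L x0 u)
                     (rescale (L `^ scale_v p theta) L x0 v).
Proof.
move=> p1 pt L0 [[Cu Cv] u0 v0 eu ev].
have [E1 E2] := scale_uv p1 pt.
have [Cu' lu] := C2_rescale (L `^ scale_u p theta) L x0 Cu.
have [Cv' lv] := C2_rescale (L `^ scale_v p theta) L x0 Cv.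
split; [by []|by apply: rescale_gt0; rewrite ?powR_gt0|by apply: rescale_gt0;
  rewrite ?powR_gt0| |] => x.
- rewrite lu /rescale -mulrN eu powRM ?powR_ge0 ?(ltW (v0 _))// -powRrM -E1.
  by rewrite powR_add// powR_mulrn// ltW.
- rewrite lv /rescale -mulrN ev powRM ?powR_ge0 ?(ltW (u0 _))// -powRrM -E2.
  by rewrite powR_add// powR_mulrn// ltW.
Qed.

Lemma linearly_stable_rescale p theta u v L x0 : 1 < p -> p <= theta -> 0 < L ->
  (forall x, 0 < u x) -> (forall x, 0 < v x) ->
  linearly_stable p theta u v ->
  linearly_stable p theta (rescale (L `^ scale_u p theta) L x0 u)
                     (rescale (L `^ scale_v p theta) L x0 v).
Proof.
move=> p1 pt L0 u0 v0 [zeta [chi [[Cz Cc] z0 c0 ez ec]]].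
have [E1 E2] := scale_uv p1 pt.
have [Cz' lz] := C2_rescale (L `^ scale_u p theta) L x0 Cz.
have [Cc' lc] := C2_rescale (L `^ scale_v p theta) L x0 Cc.
exists (rescale (L `^ scale_u p theta) L x0 zeta).
exists (rescale (L `^ scale_v p theta) L x0 chi).
split; [by []|by apply: rescale_gt0; rewrite ?powR_gt0|by apply: rescale_gt0;
  rewrite ?powR_gt0| |] => x.
- rewrite lz /rescale -mulrN ez powRM ?powR_ge0 ?(ltW (v0 _))// -powRrM.
  rewrite -(powR_mulrn _ (ltW L0)) -powR_add// E1
    (_ : scale_v p theta * p = scale_v p theta * (p - 1) + scale_v p theta).
    by rewrite (powR_add _ _ L0); ring.
  by ring.
- rewrite lc /rescale -mulrN ec powRM ?powR_ge0 ?(ltW (u0 _))// -powRrM.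
  rewrite -(powR_mulrn _ (ltW L0)) -powR_add// E2
    (_ : scale_u p theta * theta = scale_u p theta * (theta - 1) + scale_u p theta).
    by rewrite (powR_add _ _ L0); ring.
  by ring.
Qed.

Lemma grid_mean_comb m a f g :
  grid_mean m (fun x => a * f x + g x) = a * grid_mean m f + grid_mean m g.
Proof. by rewrite grid_meanD grid_meanZ. Qed.

(** Both derivatives are moved from f to the cutoff, by two applications of
    [green]. *)
Lemma green_cutoff f K : C2 f -> (forall x, 0 < f x) -> \forall m \near \oo,
  grid_mean m (fun x => - laplacian f x * cutoff K.+3 x) <=
  K.+3%:R * (4 * K.+2%:R + 2 * N%:R) * grid_mean m (fun x => f x * cutoff K.+1 x) + 2.
Proof.
move=> Cf f0; have Cc := @C2_cutoff R N K.
have H1 := green Cf (C2_C1 Cc) (fun i => vanishes_mulr _ (@cutoff_vanishes R N _)).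
have H2 := green Cc (C2_C1 Cf) (fun i => vanishes_mull _ (@partial_cutoff_vanishes R N _ i)).
apply: filterS2 H1 H2 => m; set c := K.+3%:R * _.
rewrite !ler_norml => /andP[h1 _] /andP[_ h2].
have : grid_mean m (fun x => - laplacian f x * cutoff K.+3 x) <=
  grid_mean m (fun x => (-1) * (laplacian f x * cutoff K.+3 x + grad_dot f (cutoff K.+3) x) +
    (1 * (laplacian (cutoff K.+3) x * f x + grad_dot (cutoff K.+3) f x) +
     (c * (f x * cutoff K.+1 x) + 0))).
  apply: grid_mean_le => x; rewrite (grad_dotC (cutoff _) f).
  have : - laplacian (cutoff K.+3) x <= c * cutoff K.+1 x.
    by have := laplacian_cutoff_le K x; rewrite ler_norml => /andP[]; rewrite -/c; lra.
  move=> /(ler_wpM2r (ltW (f0 x))).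
  move: (laplacian (cutoff K.+3) x) (laplacian f x) (grad_dot f _ x).
  by move: (cutoff K.+3 x) (cutoff K.+1 x) (f x) => a b d l1 l2 l3; clear; lra.
by rewrite !grid_mean_comb grid_mean_cst; lra.
Qed.

(** Testing -Delta u = v^p with a cutoff bounds the mean of v^p by the mean of u
    against a lower power of the cutoff, hence by a small multiple of the mean of
    u^theta ([young_cutoff], as theta > 1), and symmetrically.  The two
    inequalities close up. *)
Lemma a_priori p theta : 1 < p -> p <= theta ->
  exists K (C : R), forall u v, lane_emden p theta u v -> \forall m \near \oo,
    grid_mean m (fun x => v x `^ p * cutoff K x) <= C.
Proof.
move=> p1 pt.
have s1 : 0 < p - 1 by lra.
have s2 : 0 < theta - 1 by lra.
(* p <= theta, so a cutoff power that is large enough for the exponent p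
   serves for theta too *)
pose K := (Num.truncn (2 / (p - 1))).+1.
have K1 : 2 / (p - 1) <= K.+1%:R.
  have := truncn_itv (ltW (divr_gt0 (ltr0n R 2) s1)) => /andP[_ /ltW h].
  by rewrite (le_trans h)// ler_nat.
have K2 : 2 / (theta - 1) <= K.+1%:R.
  by rewrite (le_trans _ K1)// ler_wpM2l// lef_pV2 ?posrE//; lra.
set c : R := K.+3%:R * (4 * K.+2%:R + 2 * N%:R).
clearbody K.
have c0 : 0 <= c.
  rewrite /c; apply: mulr_ge0; first exact: ler0n.
  by apply: addr_ge0; apply: mulr_ge0; rewrite ?ler0n.
(* e is chosen such that c e <= 1/2, which lets both means be absorbed *)
have e0 : 0 < (2 * (c + 1))^-1 by rewrite invr_gt0; lra.
have ce : c * (2 * (c + 1))^-1 <= 2^-1.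
  by rewrite ler_pdivrMr; last lra; rewrite mulrA mulVf// mul1r; lra.
have [M1 M10 Y1] := @young_cutoff R N _ _ _ s1 e0 K1.
have [M2 M20 Y2] := @young_cutoff R N _ _ _ s2 e0 K2.
set e := (2 * (c + 1))^-1 in e0 ce Y1 Y2.
exists K.+3, (2 * (4 + c * M1 + c * M2)) => u v [[Cu Cv] u0 v0 eu ev].
apply: filterS2 (green_cutoff K Cu u0) (green_cutoff K Cv v0) => m.
have /le_trans/[apply] : grid_mean m (fun x => v x `^ p * cutoff K.+3 x) <=
    grid_mean m (fun x => - laplacian u x * cutoff K.+3 x).
  by apply: grid_mean_le => x; rewrite eu.
move=> Hv.
have /le_trans/[apply] : grid_mean m (fun x => u x `^ theta * cutoff K.+3 x) <=
    grid_mean m (fun x => - laplacian v x * cutoff K.+3 x).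
  by apply: grid_mean_le => x; rewrite ev.
move: Hv; rewrite -/c.
have Yv : grid_mean m (fun x => v x * cutoff K.+1 x) <=
    grid_mean m (fun x => e * (v x `^ p * cutoff K.+3 x) + M1).
  apply: grid_mean_le => x; have := Y1 (v x) x (ltW (v0 x)).
  by rewrite (addrC 1) subrK.
have Yu : grid_mean m (fun x => u x * cutoff K.+1 x) <=
    grid_mean m (fun x => e * (u x `^ theta * cutoff K.+3 x) + M2).
  apply: grid_mean_le => x; have := Y2 (u x) x (ltW (u0 x)).
  by rewrite (addrC 1) subrK.
move: Yu Yv; rewrite !grid_mean_comb !grid_mean_cst.
have : 0 <= grid_mean m (fun x => u x `^ theta * cutoff K.+3 x).
  rewrite -[leLHS](grid_mean_cst N m); apply: grid_mean_le => x.
  by rewrite mulr_ge0 ?powR_ge0 ?cutoff_ge0.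
have : 0 <= grid_mean m (fun x => v x `^ p * cutoff K.+3 x).
  rewrite -[leLHS](grid_mean_cst N m); apply: grid_mean_le => x.
  by rewrite mulr_ge0 ?powR_ge0 ?cutoff_ge0.
move: (grid_mean m _) (grid_mean m _) (grid_mean m _) (grid_mean m _) => A B U V A0 B0 hU hV h1 h2.
have h3 := ler_wpM2l c0 hU; have h4 := ler_wpM2l c0 hV.
have h5 := ler_wpM2r A0 ce; have h6 := ler_wpM2r B0 ce.
have h7 := mulr_ge0 c0 M10; have h8 := mulr_ge0 c0 M20.
clearbody c e; rewrite !mulrDr !mulrA in h3 h4; lra.
Qed.

End System.

(** * Pointwise comparison of the two components *)

Section Comparison.
Variables (R : realType) (N : nat).
Implicit Types (u v f g : 'rV[R]_N -> R) (i : 'I_N) (x : 'rV[R]_N) (p theta : R).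
Local Opaque cutoff grid_mean grad_dot laplacian powR partial paraboloid.

Definition sigma p theta : R := (p + 1) / (theta + 1).
(** The normalisation for which kappa^(theta + 1) = sigma; the pointwise bound
    kappa u <= v^sigma is then u^(theta + 1) / (theta + 1) <= v^(p + 1) / (p + 1). *)
Definition kappa p theta : R := sigma p theta `^ (theta + 1)^-1.

Lemma sigma_gt0 p theta : 1 < p -> p <= theta -> 0 < sigma p theta.
Proof. by move=> p1 pt; rewrite divr_gt0//; lra. Qed.

Lemma sigma_le1 p theta : 1 < p -> p <= theta -> sigma p theta <= 1.
Proof. by move=> p1 pt; rewrite ler_pdivrMr; lra. Qed.

Lemma kappa_gt0 p theta : 1 < p -> p <= theta -> 0 < kappa p theta.
Proof. by move=> p1 pt; exact/powR_gt0/sigma_gt0. Qed.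

Lemma kappa_pow p theta : 1 < p -> p <= theta ->
  kappa p theta `^ (theta + 1) = sigma p theta.
Proof.
move=> p1 pt; have s0 := sigma_gt0 p1 pt.
have t1 : theta + 1 != 0 by rewrite gt_eqF//; lra.
by rewrite -powRrM mulVf// powRr1// ltW.
Qed.

Lemma powR_diff_ge (a b t : R) : 0 < b -> b <= a -> 1 <= t ->
  a `^ (t - 1) * (a - b) <= a `^ t - b `^ t.
Proof.
move=> b0 ba t1; have a0 : 0 < a by exact: lt_le_trans ba.
rewrite (powR_pred t a0) (powR_pred t b0).
have : b `^ (t - 1) <= a `^ (t - 1) by apply: ler_powR2r; [lra|exact: ltW|].
by move=> /(ler_wpM2r (ltW b0)); lra.
Qed.

(** The right-hand side is a lower bound for the Laplacian of kappa u - v^sigma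
    where (u, v) takes the value (U, V).  By the choice of kappa it equals
    kappa V^(sigma - 1) (A^theta - B^theta) with A = kappa U and B = V^sigma.
    Since sigma <= 1 and B < A, the first factor is at least
    A^((sigma - 1) / sigma) and the second at least A^(theta - 1) (A - B); the
    two powers of A combine to one of exponent (p theta - 1) / (p + 1) > 0. *)
Lemma kappa_superlinear p theta (U V : R) : 1 < p -> p <= theta -> 0 < U -> 0 < V ->
  V `^ sigma p theta < kappa p theta * U ->
  kappa p theta * (kappa p theta * U - V `^ sigma p theta) `^
     (1 + (p * theta - 1) / (p + 1)) <=
  sigma p theta * (U `^ theta * V `^ (sigma p theta - 1)) - kappa p theta * V `^ p.
Proof.
move=> p1 pt U0 V0; set s := sigma p theta; set k := kappa p theta.
have s0 : 0 < s := sigma_gt0 p1 pt; have s1 : s <= 1 := sigma_le1 p1 pt.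
have k0 : 0 < k := kappa_gt0 p1 pt.
set a := k * U; set b := V `^ s => ba.
have b0 : 0 < b by exact: powR_gt0.
have a0 : 0 < a by exact: mulr_gt0.
have t1 : theta + 1 != 0 by rewrite gt_eqF//; lra.
have q1 : p + 1 != 0 by rewrite gt_eqF//; lra.
set e := (p * theta - 1) / (p + 1).
have e0 : 0 < e by rewrite divr_gt0; nra.
have E1 : s * U `^ theta = k * a `^ theta.
  rewrite /a powRM ?ltW// mulrA; congr (_ * _).
  rewrite -[k in k * _]powRr1 ?ltW// -powR_add// addrC -/k.
  by rewrite /s -kappa_pow.
have E2 : V `^ p = V `^ (s - 1) * b `^ theta.
  rewrite /b -powRrM -powR_add//; congr (_ `^ _).
  by rewrite /s /sigma; field.
have E3 : a `^ ((s - 1) / s) <= V `^ (s - 1).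
  have -> : V `^ (s - 1) = b `^ ((s - 1) / s).
    by rewrite /b -powRrM; congr (_ `^ _); field; exact: lt0r_neq0.
  rewrite -(opprK ((s - 1) / s)) (powRN a) (powRN b) lef_pV2 ?posrE ?powR_gt0//.
  by apply: ler_powR2r; rewrite ?(ltW b0) ?(ltW ba)// -mulNr opprB divr_ge0// ?subr_ge0// ltW.
have E4 : (a - b) `^ (1 + e) <= (a `^ (theta - 1) * (a - b)) * a `^ ((s - 1) / s).
  have ab : 0 < a - b by rewrite subr_gt0.
  rewrite mulrAC -powR_add// (_ : theta - 1 + (s - 1) / s = e).
    rewrite powR_add// powRr1 ?(ltW ab)// mulrC ler_wpM2r ?(ltW ab)//.
    by apply: ler_powR2r; rewrite ?(ltW e0) ?(ltW ab)// gerBl ltW.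
  by rewrite /e /s /sigma; field; rewrite q1 t1.
have E5 := powR_diff_ge b0 (ltW ba) (ltW (lt_le_trans p1 pt)).
have -> : s * (U `^ theta * V `^ (s - 1)) - k * V `^ p =
  k * ((a `^ theta - b `^ theta) * V `^ (s - 1)).
  by rewrite mulrA E1 E2; ring.
rewrite ler_pM2l//; apply: le_trans E4 _.
by apply: ler_pM; rewrite ?mulr_ge0 ?powR_ge0// subr_ge0 ltW.
Qed.

Definition excess p theta u v x : R := kappa p theta * u x - v x `^ sigma p theta.

Lemma C1_excess p theta u v : C1 u -> C1 v -> (forall x, 0 < v x) ->
  C1 (excess p theta u v).
Proof.
move=> Cu Cv v0.
rewrite (_ : excess _ _ _ _ = (fun x => kappa p theta * u x + -1 * v x `^ sigma p theta)).
  by apply: C1D; apply: C1M; [exact: C1_cst| |exact: C1_cst|exact: C1_powR].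
by apply/funext => x; rewrite /excess mulN1r.
Qed.

Lemma grad_dot_excess p theta u v f x : C1 u -> C1 v -> (forall x, 0 < v x) ->
  grad_dot (excess p theta u v) f x = kappa p theta * grad_dot u f x -
    sigma p theta * v x `^ (sigma p theta - 1) * grad_dot v f x.
Proof.
move=> Cu Cv v0; rewrite grad_dotC.
rewrite (_ : excess _ _ _ _ = (fun x => kappa p theta * u x + -1 * v x `^ sigma p theta)).
  have Cs : C1 (fun x => v x `^ sigma p theta) by exact: C1_powR.
  have Ck : C1 (fun _ : 'rV[R]_N => kappa p theta) by exact: C1_cst.
  have C1m : C1 (fun _ : 'rV[R]_N => -1 : R) by exact: C1_cst.
  rewrite (grad_dotDr _ _ (C1M Ck Cu) (C1M C1m Cs)) (grad_dotMr _ _ Ck Cu) (grad_dotMr _ _ C1m Cs).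
  rewrite !grad_dot_cst (grad_dot_powR _ _ _ v0 Cv) (grad_dotC f u) (grad_dotC f v).
  by move: (grad_dot u f x) (grad_dot v f x) => a b; ring.
by apply/funext => y; rewrite /excess mulN1r.
Qed.

Lemma grad_dot_cutoff_test f g n K x : C1 g ->
  grad_dot f (fun x => pos_part (g x) ^+ n.+2 * cutoff K.+2 x) x =
  pos_part (g x) ^+ n.+2 * (K.+2%:R * cutoff K.+1 x * grad_dot f (@paraboloid R N) x) +
  cutoff K.+2 x * (n.+2%:R * pos_part (g x) ^+ n.+1 * grad_dot f g x).
Proof.
move=> Cg; rewrite grad_dotMr; [|exact: C1_pos_partX|exact: C1_cutoff].
by rewrite grad_dot_cutoff grad_dot_pos_partX.
Qed.

(** Testing the inequality of [kappa_superlinear] with w_+^(n + 2) times a cutoff,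
    where w = kappa u - v^sigma, the gradient of w gives a term of good
    sign that absorbs the one coming from the cutoff.  What is left is
    the mean of w_+^(n + 3), which [young_cutoff] absorbs because the power on the
    left is larger. *)
Lemma excess_bound p theta n : 1 < p -> p <= theta ->
  exists K (C : R), forall u v, lane_emden p theta u v -> \forall m \near \oo,
    grid_mean m (fun x => pos_part (excess p theta u v x) `^ (n.+3%:R + (p * theta - 1) / (p + 1))
      * cutoff K x) <= C.
Proof.
move=> p1 pt; set e := (p * theta - 1) / (p + 1).
have e0 : 0 < e by rewrite divr_gt0; nra.
set s := sigma p theta; set k := kappa p theta.
have s0 : 0 < s := sigma_gt0 p1 pt; have s1 : s <= 1 := sigma_le1 p1 pt.
have k0 : 0 < k := kappa_gt0 p1 pt.
have n0 : 0 < n.+3%:R :> R by rewrite ltr0n.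
have en0 : 0 < e / n.+3%:R by rewrite divr_gt0.
have [K KP] : exists K, 2 / (e / n.+3%:R) <= K.+1%:R.
  have := truncn_itv (ltW (divr_gt0 (ltr0n R 2) en0)) => /andP[_ /ltW h].
  by eexists; exact: h.
set d : R := K.+3%:R ^+ 2 / n.+2%:R.
(* d is the constant left by completing the square in the gradient of w *)
have d0 : 0 <= d by rewrite divr_ge0// sqr_ge0.
have dd0 : 0 < k / (2 * (d + 1)) by rewrite divr_gt0//; lra.
have dE : d * (k / (2 * (d + 1))) <= k / 2.
  rewrite mulrA ler_pdivrMr; last lra.
  by have := mulr_ge0 d0 (ltW k0); lra.
have [C C0 YC] := @young_cutoff R N _ _ _ en0 dd0 KP.
exists K.+3, (2 / k * (k + s + d * C)) => u v [[Cu Cv] u0 v0 eu ev].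
have Cu1 := C2_C1 Cu; have Cv1 := C2_C1 Cv.
set w := excess p theta u v.
have Cw : C1 w by exact: C1_excess.
pose g x := pos_part (w x) ^+ n.+2 * cutoff K.+3 x.
pose h x := v x `^ (s - 1) * g x.
have Cg : C1 g by apply: C1M; [exact: C1_pos_partX|exact: C1_cutoff].
have Cs : C1 (fun x => v x `^ (s - 1)) by exact: C1_powR.
have Ch : C1 h := C1M Cs Cg.
have Vg : vanishes_off_cube g by exact/vanishes_mulr/cutoff_vanishes.
have Vh : vanishes_off_cube h by exact/vanishes_mulr.
have H1 := green Cu Cg (fun i => vanishes_mulr _ Vg).
have H2 := green Cv Ch (fun i => vanishes_mulr _ Vh).
apply: filterS2 H1 H2 => m.
rewrite !ler_norml => /andP[_ h1] /andP[h2 _].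
set b : R := n.+3%:R + e.
have b0 : b != 0 by rewrite gt_eqF// addr_gt0.
have main : grid_mean m (fun x => k * (pos_part (w x) `^ b * cutoff K.+3 x) + 0) <=
  grid_mean m (fun x => k * (laplacian u x * g x + grad_dot u g x) +
    ((- s) * (laplacian v x * h x + grad_dot v h x) +
     (d * (pos_part (w x) ^+ n.+3 * cutoff K.+1 x) + 0))).
  apply: grid_mean_le => x.
  have -> : laplacian u x = - v x `^ p by rewrite -eu opprK.
  have -> : laplacian v x = - u x `^ theta by rewrite -ev opprK.
  have -> : grad_dot v h x = v x `^ (s - 1) * grad_dot v g x + g x *
    ((s - 1) * v x `^ (s - 1 - 1) * grad_dot v v x).
    by rewrite (grad_dotMr _ _ Cs Cg) (grad_dot_powR _ _ _ v0 Cv1).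
  have A : k * (pos_part (w x) `^ b * cutoff K.+3 x) <=
      g x * (s * (u x `^ theta * v x `^ (s - 1)) - k * v x `^ p).
    have [w0|w0] := leP (w x) 0.
      by rewrite /g !pos_part_eq0// powR0// expr0n /= !(mul0r, mulr0).
    have := kappa_superlinear p1 pt (u0 x) (v0 x); rewrite -subr_gt0 => /(_ w0).
    have -> : pos_part (w x) `^ b = pos_part (w x) ^+ n.+2 * pos_part (w x) `^ (1 + e).
      rewrite -powR_mulrn ?pos_part_ge0// -powR_add; last by rewrite pos_part_id// ltW.
      by rewrite /b -[n.+3%:R]natr1 addrA.
    have g0 : 0 <= g x by rewrite mulr_ge0 ?exprn_ge0 ?pos_part_ge0 ?cutoff_ge0.
    move=> /(ler_wpM2l g0); apply: le_trans; rewrite /g (pos_part_id (ltW w0)).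
    by rewrite le_eqVlt; apply/orP; left; apply/eqP; rewrite /w /excess -/k -/s -/e; ring.
  (* v^sigma is concave in v: the second-order term has a sign *)
  have B : 0 <= g x * (s * (1 - s) * v x `^ (s - 1 - 1) * grad_dot v v x).
    have g0 : 0 <= g x by rewrite mulr_ge0 ?exprn_ge0 ?pos_part_ge0 ?cutoff_ge0.
    have s10 : 0 <= 1 - s by rewrite subr_ge0.
    apply: mulr_ge0 => //; apply: mulr_ge0; last exact: grad_dot_ge0.
    by apply: mulr_ge0; [apply: mulr_ge0 => //; exact: ltW|exact: powR_ge0].
  have D : 0 <= grad_dot w g x + d * (pos_part (w x) ^+ n.+3 * cutoff K.+1 x).
    rewrite grad_dot_cutoff_test//.
    have Z4 := @cutoff_dot_le R N K x.
    have := grad_dot_sqr_ge0 w (@paraboloid R N) (2 * n.+2%:R * pos_part (paraboloid x))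
      (K.+3%:R * pos_part (w x)) x.
    have -> : cutoff K.+3 x = cutoff K.+1 x * pos_part (paraboloid x) ^+ 2.
      by rewrite 2!cutoffS expr2 mulrA.
    rewrite (cutoffS K.+1).
    rewrite (exprS _ n.+2) (exprS _ n.+1) /d.
    have c0 := cutoff_ge0 K.+1 x.
    have W0 := pos_part_ge0 (w x).
    have W10 := exprn_ge0 n.+1 W0.
    have q0 : 0 < n.+2%:R :> R by rewrite ltr0n.
    move: Z4 c0 W0 W10 q0; move: (grad_dot w w x) (grad_dot w (@paraboloid R N) x)
      (grad_dot (@paraboloid R N) _ x) (cutoff _ x).
    move: (pos_part (w x)) (pos_part (paraboloid x)) (n.+2%:R) (K.+3%:R).
    move=> W r q j; move: (W ^+ n.+1) => W1 X Y Z c Z4 c0 W0 W10 q0 sq.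
    have cW : 0 <= c * W1 / (4 * q) by rewrite divr_ge0 ?mulr_ge0// ltW.
    have h3 := mulr_ge0 cW sq.
    have qW : 0 <= W1 * W ^+ 2 * j ^+ 2 / (4 * q).
      apply: divr_ge0; last by apply: mulr_ge0 => //; exact: ltW.
      by apply: mulr_ge0; [apply: mulr_ge0 => //|]; exact: sqr_ge0.
    have h4 := ler_wpM2l qW Z4.
    have -> : W * W1 * (j * (c * r) * Y) + c * r ^+ 2 * (q * W1 * X) +
        j ^+ 2 / q * (W * (W * W1) * c) =
      (c * W1 / (4 * q) * ((2 * q * r) ^+ 2 * X + 2 * (2 * q * r) * (j * W) * Y +
         (j * W) ^+ 2 * Z)) +
      (W1 * W ^+ 2 * j ^+ 2 / (4 * q) * (4 * c) - W1 * W ^+ 2 * j ^+ 2 / (4 * q) * (c * Z)).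
      by field; rewrite gt_eqF.
    by rewrite addr_ge0// subr_ge0.
  move: D; rewrite grad_dot_excess// -/k -/s /h => D.
  lra.
move: main; rewrite !grid_mean_comb !grid_mean_cst.
have Y : grid_mean m (fun x => pos_part (w x) ^+ n.+3 * cutoff K.+1 x) <=
    grid_mean m (fun x => k / (2 * (d + 1)) * (pos_part (w x) `^ b * cutoff K.+3 x) + C).
  apply: grid_mean_le => x.
  have X0 : 0 <= pos_part (w x) ^+ n.+3 by rewrite exprn_ge0 ?pos_part_ge0.
  have E : (pos_part (w x) ^+ n.+3) `^ (1 + e / n.+3%:R) = pos_part (w x) `^ b.
    rewrite -powR_mulrn ?pos_part_ge0// -powRrM; congr (_ `^ _).
    by rewrite /b; field; rewrite gt_eqF.
  by rewrite -E; exact: YC.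
move: Y; rewrite grid_mean_comb grid_mean_cst.
have : 0 <= grid_mean m (fun x => pos_part (w x) `^ b * cutoff K.+3 x).
  rewrite -[leLHS](grid_mean_cst N m); apply: grid_mean_le => x.
  by rewrite mulr_ge0 ?powR_ge0 ?cutoff_ge0.
move: (grid_mean m _) (grid_mean m _) (grid_mean m _) (grid_mean m _) h1 h2 =>
  A B G1 G2 h1 h2 A0 hB main.
have e1 := ler_wpM2l d0 hB; have e2 := ler_wpM2r A0 dE.
have e3 := ler_wpM2l (ltW k0) h1; have e4 := ler_wpM2l (ltW s0) h2.
rewrite mulrAC ler_pdivlMr//; move: main; rewrite !addr0 mulNr.
by rewrite mulrDr mulrA in e1; lra.
Qed.

Lemma pos_partZ (c t : R) : 0 <= c -> pos_part (c * t) = c * pos_part t.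
Proof. by move=> c0; rewrite /pos_part maxr_pMr// mulr0. Qed.

Lemma scale_u_gt0 p theta : 1 < p -> p <= theta -> 0 < scale_u p theta :> R.
Proof. by move=> p1 pt; rewrite /scale_u divr_gt0//; nra. Qed.

Lemma scale_v_gt0 p theta : 1 < p -> p <= theta -> 0 < scale_v p theta :> R.
Proof. by move=> p1 pt; rewrite /scale_v divr_gt0//; nra. Qed.

Lemma excess_rescale p theta u v L x0 : 1 < p -> p <= theta -> 0 < L ->
  (forall x, 0 < v x) ->
  excess p theta (rescale (L `^ scale_u p theta) L x0 u)
                 (rescale (L `^ scale_v p theta) L x0 v) =
  rescale (L `^ scale_u p theta) L x0 (excess p theta u v).
Proof.
move=> p1 pt L0 v0; apply/funext => x; rewrite /excess /rescale.
have h : p * theta - 1 != 0 by rewrite gt_eqF// subr_gt0; nra.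
have t1 : theta + 1 != 0 by rewrite gt_eqF//; lra.
rewrite powRM ?powR_ge0 ?(ltW (v0 _))// -powRrM.
have -> : scale_v p theta * sigma p theta = scale_u p theta.
  by rewrite /scale_v /scale_u /sigma; field; rewrite h t1.
ring.
Qed.

Lemma C1_continuous f : (0 < N)%N -> C1 f -> continuous f.
Proof. by move=> N0 Cf; have [] := Cf (Ordinal N0). Qed.

(** If w = kappa u - v^sigma were positive somewhere, the bound of
    [excess_bound] would contradict [blowup] for n large, because w scales like u. *)
Lemma comparison p theta u v : (0 < N)%N -> 1 < p -> p <= theta -> lane_emden p theta u v ->
  forall x, kappa p theta * u x <= v x `^ sigma p theta.
Proof.
move=> N0 p1 pt LE x; rewrite -subr_le0 leNgt; apply/negP => w0.
have a0 := scale_u_gt0 p1 pt.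
have e0 : 0 < (p * theta - 1) / (p + 1) by rewrite divr_gt0; nra.
have [n nP] : exists n, N%:R / scale_u p theta < n.+1%:R.
  have := truncn_itv (divr_ge0 (ler0n R N) (ltW a0)) => /andP[_ h].
  by eexists; exact: h.
have [K [C HC]] := @excess_bound p theta n p1 pt.
have [[Cu Cv] u0 v0 _ _] := LE.
have cw : continuous (fun x => pos_part (excess p theta u v x)).
  apply: continuous_pos_part.
  by apply: C1_continuous => //; apply: C1_excess => //; exact: C2_C1.
apply: (@blowup R N (fun x => pos_part (excess p theta u v x)) x (scale_u p theta)
  (n.+3%:R + (p * theta - 1) / (p + 1)) C K) => //.
- by move=> y; exact: pos_part_ge0.
- by rewrite pos_part_id// ltW.
- by rewrite addr_ge0// ltW.
- rewrite mulrC -ltr_pdivrMr//; apply: (lt_trans nP).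
  by rewrite (@lt_le_trans _ _ n.+3%:R) ?ltr_nat// lerDl ltW.
move=> L L1; have L0 : 0 < L by exact: lt_le_trans L1.
have := HC _ _ (lane_emden_rescale x p1 pt L0 LE).
rewrite excess_rescale//; apply: filterS => m; apply: le_trans.
by apply: grid_mean_le => y; rewrite /rescale pos_partZ ?powR_ge0.
Qed.

End Comparison.

(** * Consequences of stability *)

Section Stability.
Variables (R : realType) (N : nat).
Implicit Types (u v f g : 'rV[R]_N -> R) (i : 'I_N) (x : 'rV[R]_N) (p theta : R).
Local Opaque cutoff grid_mean grad_dot laplacian powR partial paraboloid.
Local Notation parab := (@paraboloid R N).

(** Barta-Picone: testing -Delta zeta with f^2 / zeta leaves
    2 (f / zeta) grad zeta . grad f - |(f / zeta) grad zeta|^2, which is at most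
    |grad f|^2. *)
Lemma picone_ineq zeta g f : C2 zeta -> (forall x, 0 < zeta x) ->
  (forall x, - laplacian zeta x = g x) -> C1 f -> vanishes_off_cube f ->
  \forall m \near \oo,
    grid_mean m (fun x => g x * (f x * f x * zeta x `^ (-1))) <=
    grid_mean m (grad_dot f f) + 1.
Proof.
move=> Cz z0 zg Cf Vf; have Cz1 := C2_C1 Cz.
have Cff : C1 (fun x => f x * f x) by exact: C1M.
have Czi : C1 (fun x => zeta x `^ (-1)) by exact: C1_powR.
have V : vanishes_off_cube (fun x => f x * f x * zeta x `^ (-1)).
  by apply/vanishes_mull/vanishes_mull.
have := green Cz (C1M Cff Czi) (fun i => vanishes_mulr _ V).
apply: filterS => m; rewrite ler_norml => /andP[h _].
have : grid_mean m (fun x => g x * (f x * f x * zeta x `^ (-1))) <=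
  grid_mean m (fun x => (-1) * (laplacian zeta x * (f x * f x * zeta x `^ (-1)) +
     grad_dot zeta (fun x => f x * f x * zeta x `^ (-1)) x) + grad_dot f f x).
  apply: grid_mean_le => x; rewrite -zg.
  rewrite (grad_dotMr _ _ Cff Czi) (grad_dotMr _ _ Cf Cf) (grad_dot_powR _ _ _ z0 Cz1).
  rewrite (powR_add _ _ (z0 x)) (grad_dotC zeta f).
  have := grad_dot_sqr_ge0 f zeta 1 (- (f x * zeta x `^ (-1))) x.
  by move: (zeta x `^ (-1)) => q; lra.
by rewrite grid_mean_comb; lra.
Qed.

Definition stability_weight p theta u v x : R :=
  Num.sqrt (p * theta) * (u x `^ ((theta - 1) / 2) * v x `^ ((p - 1) / 2)).

(** The mean of the two inequalities given by [picone_ineq] for zeta and chi; the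
    unknown ratio chi / zeta disappears by the inequality between arithmetic and
    geometric means. *)
Lemma stability_inequality p theta u v f : 1 < p -> p <= theta ->
  (forall x, 0 < u x) -> (forall x, 0 < v x) ->
  linearly_stable p theta u v -> C1 f -> vanishes_off_cube f ->
  \forall m \near \oo,
    grid_mean m (fun x => stability_weight p theta u v x * (f x * f x)) <=
      grid_mean m (grad_dot f f) + 1.
Proof.
move=> p1 pt u0 v0 [zeta [chi [[Cz Cc] z0 c0 ez ec]]] Cf Vf.
apply: filterS2 (picone_ineq Cz z0 ez Cf Vf) (picone_ineq Cc c0 ec Cf Vf) => m h1 h2.
have : grid_mean m (fun x => stability_weight p theta u v x * (f x * f x)) <=
  grid_mean m (fun x => 2^-1 * (p * v x `^ (p - 1) * chi x * (f x * f x * zeta x `^ (-1))) +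
                   (2^-1 * (theta * u x `^ (theta - 1) * zeta x * (f x * f x * chi x `^ (-1))) +
                     0)).
  apply: grid_mean_le => x; rewrite (powR_inv1 (ltW (z0 x))) (powR_inv1 (ltW (c0 x))) addr0.
  have -> : 2^-1 * (p * v x `^ (p - 1) * chi x * (f x * f x * (zeta x)^-1)) +
    2^-1 * (theta * u x `^ (theta - 1) * zeta x * (f x * f x * (chi x)^-1)) =
    (p * v x `^ (p - 1) * (chi x / zeta x) +
      theta * u x `^ (theta - 1) * (zeta x / chi x)) / 2 * (f x * f x) by field; rewrite !gt_eqF.
  apply: ler_wpM2r; first exact: sqr_ge0.
  rewrite ler_pdivlMr//.
  set a := p * v x `^ (p - 1) * (chi x / zeta x).
  set b := theta * u x `^ (theta - 1) * (zeta x / chi x).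
  have a0 : 0 <= a by rewrite !mulr_ge0 ?powR_ge0 ?invr_ge0 ?(ltW (c0 _)) ?(ltW (z0 _))//; lra.
  have b0 : 0 <= b by rewrite !mulr_ge0 ?powR_ge0 ?invr_ge0 ?(ltW (c0 _)) ?(ltW (z0 _))//; lra.
  have w0 : 0 <= stability_weight p theta u v x by rewrite !mulr_ge0 ?powR_ge0 ?sqrtr_ge0.
  have wE : stability_weight p theta u v x ^+ 2 = a * b.
    rewrite /stability_weight !exprMn sqr_sqrtr; last by rewrite mulr_ge0//; lra.
    rewrite -!powR_mulrn ?powR_ge0// -!powRrM !divfK ?pnatr_eq0// /a /b.
    by field; rewrite !gt_eqF.
  have [//|h] := leP (stability_weight p theta u v x * 2) (a + b).
  have : (a + b) ^+ 2 < (stability_weight p theta u v x * 2) ^+ 2.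
    by rewrite ltrXn2r// ?nnegrE ?addr_ge0.
  rewrite exprMn wE; have := sqr_ge0 (a - b); lra.
by rewrite !grid_mean_comb grid_mean_cst; lra.
Qed.

(** The bookkeeping for Young inequalities: a quantity X that is bounded by
    e G + Q / e for every e may be absorbed into a multiple of G. *)
Lemma absorb (a b c d : R) : 0 < a -> 0 <= b -> 0 <= c -> 0 <= d ->
  exists2 C, 0 <= C & forall G X Q, 0 <= G -> 0 <= Q ->
    (forall e, 0 < e -> X <= e * G + e^-1 * Q) -> a * G <= b + c * X + d * Q ->
    G <= C * (1 + Q) /\ X <= C * (1 + Q).
Proof.
move=> a0 b0 c0 d0; set e := a / (2 * (c + 1)).
have e0 : 0 < e by rewrite divr_gt0//; lra.
have ce : c * e <= a / 2.
  rewrite mulrA ler_pdivrMr; last lra.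
  by have := mulr_ge0 c0 (ltW a0); lra.
have ei0 : 0 < e^-1 by rewrite invr_gt0.
pose D := 2 / a * (b + (c / e + d)).
have D0 : 0 <= D.
  by apply: mulr_ge0; [apply: divr_ge0 => //; exact: ltW|apply: addr_ge0 => //;
    apply: addr_ge0 => //; apply: divr_ge0 => //; exact: ltW].
have De : 0 <= e * D by apply: mulr_ge0 => //; exact: ltW.
exists (D + e * D + e^-1); first by apply: addr_ge0; [exact: addr_ge0|exact: ltW].
move=> G X Q G0 Q0 HX HG.
have HXe := HX e e0.
have h1 := ler_wpM2l c0 HXe; have h2 := ler_wpM2r G0 ce.
have bQ := mulr_ge0 b0 Q0.
have cQ : 0 <= c / e by apply: divr_ge0 => //; exact: ltW.
have GD : G <= D * (1 + Q).
  rewrite /D -mulrA mulrAC ler_pdivlMr// mulrC.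
  clearbody e; rewrite !mulrDr !mulrA in h1 *; nra.
have h3 := ler_wpM2l (ltW e0) GD.
have DQ := mulr_ge0 D0 Q0; have eDQ := mulr_ge0 De Q0.
have eQ := mulr_ge0 (ltW ei0) Q0.
by clearbody D e; split; lra.
Qed.

(** The comparison, raised to the power (theta + 1) / 2, trades part of the
    weight for powers of u; the constant becomes
    sqrt (p theta sigma) = sqrt z. *)
Lemma stability_weight_ge p theta u v x : 1 < p -> p <= theta -> 0 < u x -> 0 < v x ->
  kappa p theta * u x <= v x `^ sigma p theta ->
  Num.sqrt (zpar p theta) * u x `^ theta <= stability_weight p theta u v x * v x.
Proof.
move=> p1 pt u0 v0 ux.
have s0 := sigma_gt0 p1 pt; have k0 := kappa_gt0 p1 pt.
have t1 : theta + 1 != 0 by rewrite gt_eqF//; lra.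
have -> : zpar p theta = p * theta * sigma p theta by rewrite /zpar /sigma; ring.
rewrite sqrtrM; last by rewrite mulr_ge0//; lra.
rewrite /stability_weight -!mulrA ler_wpM2l ?sqrtr_ge0//.
have -> : u x `^ theta = u x `^ ((theta - 1) / 2) * u x `^ ((theta + 1) / 2).
  by rewrite -powR_add//; congr (_ `^ _); field.
rewrite mulrCA ler_wpM2l ?powR_ge0//.
have -> : v x `^ ((p - 1) / 2) * v x = v x `^ ((p + 1) / 2).
  by rewrite -{2}(powRr1 (ltW v0)) -powR_add//; congr (_ `^ _); field.
have -> : v x `^ ((p + 1) / 2) = (v x `^ sigma p theta) `^ ((theta + 1) / 2).
  by rewrite -powRrM; congr (_ `^ _); rewrite /sigma; field.
have -> : Num.sqrt (sigma p theta) = kappa p theta `^ ((theta + 1) / 2).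
  rewrite -powR12_sqrt ?(ltW s0)// -{1}(kappa_pow p1 pt) -powRrM.
  by congr (_ `^ _).
rewrite -powRM ?(ltW k0) ?(ltW u0)//; apply: ler_powR2r => //.
  by rewrite divr_ge0//; lra.
by rewrite mulr_ge0 ?ltW.
Qed.

(** Young's inequality for the terms in which a derivative has fallen on the
    cutoff; |grad paraboloid|^2 <= 4 on the support. *)
Lemma cross_young v t e n x : (forall x, 0 < v x) -> 0 < e ->
  `|v x `^ (2 * t - 1) * cutoff n.+3 x * grad_dot v parab x| <=
  e * (v x `^ (2 * t - 1 - 1) * cutoff n.+4 x * grad_dot v v x) +
  e^-1 * (v x `^ (2 * t) * cutoff n.+2 x).
Proof.
move=> v0 e0.
have -> : v x `^ (2 * t) = v x `^ (2 * t - 1 - 1) * v x ^+ 2.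
  by rewrite powR_pred// (powR_pred (2 * t - 1))// expr2 mulrA.
rewrite (powR_pred (2 * t - 1))//.
have -> : cutoff n.+4 x = cutoff n.+2 x * pos_part (paraboloid x) ^+ 2.
  by rewrite 2!cutoffS expr2 mulrA.
rewrite (cutoffS n.+2).
have h1 := grad_dot_sqr_ge0 v parab (2 * e * pos_part (paraboloid x)) (v x) x.
have h2 := grad_dot_sqr_ge0 v parab (2 * e * pos_part (paraboloid x)) (- v x) x.
have Z4 := @cutoff_dot_le R N n.+1 x.
have w0 := powR_ge0 (v x) (2 * t - 1 - 1).
have c0 := cutoff_ge0 n.+2 x.
move: (v x `^ (2 * t - 1 - 1)) w0 => w w0.
move: h1 h2 Z4 c0; move: (grad_dot v v x) (grad_dot v parab x) (grad_dot parab parab x).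
move: (cutoff n.+2 x) (pos_part (paraboloid x)) (v x).
move=> c r V X Y Z h1 h2 Z4 c0.
have wc : 0 <= w * c / (4 * e).
  apply: divr_ge0; first exact: mulr_ge0.
  by apply: mulr_ge0 => //; exact: ltW.
have h3 := mulr_ge0 wc h1; have h4 := mulr_ge0 wc h2.
have wV : 0 <= w * V ^+ 2 / (4 * e).
  apply: divr_ge0; last by apply: mulr_ge0 => //; exact: ltW.
  by apply: mulr_ge0 => //; exact: sqr_ge0.
have h5 := ler_wpM2l wV Z4.
have E (W : R) : w * c / (4 * e) * ((2 * e * r) ^+ 2 * X + 2 * (2 * e * r) * W * Y +
    W ^+ 2 * Z) = e * (w * (c * r ^+ 2) * X) + w * W * (c * r) * Y +
    w * W ^+ 2 / (4 * e) * (c * Z) by field; rewrite gt_eqF.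
have E5 : w * V ^+ 2 / (4 * e) * (4 * c) = e^-1 * (w * V ^+ 2 * c).
  by field; rewrite gt_eqF.
rewrite E5 in h5.
rewrite E in h3; rewrite E sqrrN in h4.
by rewrite ler_norml; apply/andP; split; lra.
Qed.

Lemma grad_dot_test v t K x : C1 v -> (forall x, 0 < v x) ->
  grad_dot (fun x => v x `^ t * cutoff K.+2 x) (fun x => v x `^ t * cutoff K.+2 x) x =
  t ^+ 2 * (v x `^ (2 * t - 1 - 1) * cutoff (K + K).+4 x * grad_dot v v x) +
  2 * t * K.+2%:R * (v x `^ (2 * t - 1) * cutoff (K + K).+3 x * grad_dot v parab x) +
  K.+2%:R ^+ 2 * (v x `^ (2 * t) * cutoff (K + K).+2 x * grad_dot parab parab x).
Proof.
move=> Cv v0; have Cvt : C1 (fun x => v x `^ t) by exact: C1_powR.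
have CP : C1 (cutoff K.+2 : 'rV[R]_N -> R) by exact: C1_cutoff.
have D f : grad_dot f (fun x => v x `^ t * cutoff K.+2 x) x =
    v x `^ t * (K.+2%:R * cutoff K.+1 x * grad_dot f parab x) +
    cutoff K.+2 x * (t * v x `^ (t - 1) * grad_dot f v x).
  by rewrite (grad_dotMr _ _ Cvt CP) grad_dot_cutoff (grad_dot_powR _ _ _ v0 Cv).
rewrite D (grad_dotC _ parab) (grad_dotC _ v) !D (grad_dotC parab v).
have -> : v x `^ (2 * t) = v x `^ t * v x `^ t.
  by rewrite -powR_add//; congr (_ `^ _); ring.
have -> : v x `^ (2 * t - 1) = v x `^ t * v x `^ (t - 1).
  by rewrite -powR_add//; congr (_ `^ _); ring.
have -> : v x `^ (2 * t - 1 - 1) = v x `^ (t - 1) * v x `^ (t - 1).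
  by rewrite -powR_add//; congr (_ `^ _); ring.
have -> : cutoff (K + K).+4 x = cutoff K.+2 x * cutoff K.+2 x.
  by rewrite cutoffM !addnS addSn.
have -> : cutoff (K + K).+3 x = cutoff K.+2 x * cutoff K.+1 x.
  by rewrite cutoffM !addnS addSn.
have -> : cutoff (K + K).+2 x = cutoff K.+1 x * cutoff K.+1 x.
  by rewrite cutoffM !addnS addSn.
ring.
Qed.

(** Write U and G for the two means on the left, Q for the one on the right
    and X for the mean of the cross term v^(2 t - 1) grad v . grad (cutoff).
    The equation for v says (2 t - 1) G = U + O(X), and stability says
    sqrt z U <= t^2 G + O(X + Q).  Eliminating U leaves G with the positive
    coefficient sqrt z (2 t - 1) - t^2, and X is absorbed. *)
Lemma energy_estimate p theta t K : (0 < N)%N -> 1 < p -> p <= theta ->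
  t ^+ 2 < Num.sqrt (zpar p theta) * (2 * t - 1) ->
  exists2 C : R, 0 <= C & forall u v, lane_emden p theta u v ->
    linearly_stable p theta u v -> \forall m \near \oo,
    grid_mean m (fun x => u x `^ theta * v x `^ (2 * t - 1) * cutoff (K + K).+4 x) <=
      C * (1 + grid_mean m (fun x => v x `^ (2 * t) * cutoff (K + K).+2 x)) /\
    grid_mean m (fun x => v x `^ (2 * t - 1 - 1) * cutoff (K + K).+4 x * grad_dot v v x) <=
      C * (1 + grid_mean m (fun x => v x `^ (2 * t) * cutoff (K + K).+2 x)).
Proof.
move=> N0 p1 pt tz; set s := Num.sqrt _ in tz *.
have s0 : 0 <= s by exact: sqrtr_ge0.
(* t^2 >= 0 forces the right factor to be positive *)
have al0 : 0 < 2 * t - 1.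
  by rewrite ltNge; apply/negP => h; have := sqr_ge0 t; have := mulr_ge0_le0 s0 h; lra.
set k : R := K.+2%:R; have k0 : 0 <= k by [].
have t0 : 0 <= t by lra.
pose a := s * (2 * t - 1) - t ^+ 2.
have a0 : 0 < a by rewrite subr_gt0.
have b0 : 0 <= 1 + s by lra.
have c0 : 0 <= 2 * k * (s + t) by apply: mulr_ge0; [exact: mulr_ge0|exact: addr_ge0].
have d0 : 0 <= 4 * k ^+ 2 by apply: mulr_ge0 => //; exact: sqr_ge0.
have [C C0 HC] := absorb a0 b0 c0 d0.
exists (C + (2 * t - 1) * C + 1 + 2 * k * C).
  have h1 := mulr_ge0 (ltW al0) C0; have h2 := mulr_ge0 k0 C0; lra.
move=> u v LE ST; have [[Cu Cv] u0 v0 eu ev] := LE.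
have Cv1 := C2_C1 Cv.
have cmp := comparison N0 p1 pt LE.
have Cvt : C1 (fun x => v x `^ t) by exact: C1_powR.
have Cvh : C1 (fun x => v x `^ (2 * t - 1)) by exact: C1_powR.
pose f x := v x `^ t * cutoff K.+2 x.
pose h x := v x `^ (2 * t - 1) * cutoff (K + K).+4 x.
have CK : C1 (cutoff K.+2 : 'rV[R]_N -> R) by exact: C1_cutoff.
have CP : C1 (cutoff (K + K).+4 : 'rV[R]_N -> R) by exact: C1_cutoff.
have Cf : C1 f := C1M Cvt CK.
have Ch : C1 h := C1M Cvh CP.
have Vf : vanishes_off_cube f by exact/vanishes_mulr/cutoff_vanishes.
have Vh : vanishes_off_cube h by exact/vanishes_mulr/cutoff_vanishes.
have H1 := stability_inequality p1 pt u0 v0 ST Cf Vf.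
have H2 := green Cv Ch (fun i => vanishes_mulr _ Vh).
apply: filterS2 H1 H2 => m h1 h2.
set U := grid_mean m (fun x => u x `^ theta * _ * _).
set G := grid_mean m (fun x => _ * grad_dot v v x).
set Q := grid_mean m (fun x => v x `^ (2 * t) * _).
pose Cr := grid_mean m (fun x => v x `^ (2 * t - 1) * cutoff (K + K).+3 x * grad_dot v parab x).
have G0 : 0 <= G.
  rewrite -[leLHS](grid_mean_cst N m); apply: grid_mean_le => x.
  apply: mulr_ge0; last exact: grad_dot_ge0.
  by apply: mulr_ge0; [exact: powR_ge0|exact: cutoff_ge0].
have Q0 : 0 <= Q.
  rewrite -[leLHS](grid_mean_cst N m); apply: grid_mean_le => x.
  by rewrite mulr_ge0 ?powR_ge0 ?cutoff_ge0.
have X e : 0 < e -> `|Cr| <= e * G + e^-1 * Q.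
  move=> e0; rewrite ler_norml; apply/andP; split.
    rewrite lerNl.
    have : grid_mean m (fun x =>
      (-1) * (v x `^ (2 * t - 1) * cutoff (K + K).+3 x * grad_dot v parab x) + 0) <=
      grid_mean m (fun x => e * (v x `^ (2 * t - 1 - 1) * cutoff (K + K).+4 x * grad_dot v v x) +
        (e^-1 * (v x `^ (2 * t) * cutoff (K + K).+2 x) + 0)).
      apply: grid_mean_le => x; have := @cross_young v t e (K + K) x v0 e0.
      by rewrite ler_norml => /andP[]; lra.
    by rewrite !grid_mean_comb grid_mean_cst -/G -/Q -/Cr !addr0 mulN1r.
  have : grid_mean m (fun x => (v x `^ (2 * t - 1) * cutoff (K + K).+3 x * grad_dot v parab x)) <=
    grid_mean m (fun x => e * (v x `^ (2 * t - 1 - 1) * cutoff (K + K).+4 x * grad_dot v v x) +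
      (e^-1 * (v x `^ (2 * t) * cutoff (K + K).+2 x) + 0)).
    apply: grid_mean_le => x; have := @cross_young v t e (K + K) x v0 e0.
    by rewrite ler_norml => /andP[]; lra.
  by rewrite !grid_mean_comb grid_mean_cst -/G -/Q -/Cr !addr0.
(* the equation for v, tested with v^(2 t - 1) times the cutoff *)
have A1 : `|- U + (2 * t - 1) * G + 2 * k * Cr| <= 1.
  move: h2; rewrite (_ : (fun x => _) = (fun x =>
      (-1) * (u x `^ theta * v x `^ (2 * t - 1) * cutoff (K + K).+4 x) +
      ((2 * t - 1) * (v x `^ (2 * t - 1 - 1) * cutoff (K + K).+4 x * grad_dot v v x) +
       (2 * k * (v x `^ (2 * t - 1) * cutoff (K + K).+3 x * grad_dot v parab x) + 0)))).
    by rewrite !grid_mean_comb grid_mean_cst -/U -/G -/Cr addr0 mulN1r addrA.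
  apply/funext => x; rewrite (grad_dotMr _ _ Cvh CP) (grad_dot_powR _ _ _ v0 Cv1) grad_dot_cutoff.
  have -> : laplacian v x = - u x `^ theta by rewrite -ev opprK.
  have -> : (K + K).+4%:R = 2 * k by rewrite /k -addn4 -addn2 !natrD; ring.
  by rewrite /h; ring.
(* stability, tested with v^t times the root of the cutoff *)
have A2 : s * U <= t ^+ 2 * G + 2 * t * k * Cr + 4 * k ^+ 2 * Q + 1.
  have : grid_mean m (fun x => s * (u x `^ theta * v x `^ (2 * t - 1) * cutoff (K + K).+4 x) + 0) <=
    grid_mean m (fun x => stability_weight p theta u v x * (f x * f x)).
    apply: grid_mean_le => x; rewrite addr0.
    have -> : f x * f x = v x * v x `^ (2 * t - 1) * cutoff (K + K).+4 x.
      rewrite /f mulrACA cutoffM !addnS addSn; congr (_ * _).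
      rewrite -(powR_add _ _ (v0 x)) [RHS]mulrC -(powR_pred (2 * t) (v0 x)).
      by congr powR; ring.
    have := stability_weight_ge p1 pt (u0 x) (v0 x) (cmp x); rewrite -/s.
    have c1 := mulr_ge0 (powR_ge0 (v x) (2 * t - 1)) (cutoff_ge0 (K + K).+4 x).
    by move=> /(ler_wpM2r c1); rewrite -!mulrA.
  have : grid_mean m (grad_dot f f) <=
    grid_mean m (fun x => t ^+ 2 * (v x `^ (2 * t - 1 - 1) * cutoff (K + K).+4 x * grad_dot v v x) +
      (2 * t * k * (v x `^ (2 * t - 1) * cutoff (K + K).+3 x * grad_dot v parab x) +
       (4 * k ^+ 2 * (v x `^ (2 * t) * cutoff (K + K).+2 x) + 0))).
    apply: grid_mean_le => x; rewrite grad_dot_test// -/k.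
    have := ler_wpM2l (mulr_ge0 (sqr_ge0 k) (powR_ge0 (v x) (2 * t)))
      (@cutoff_dot_le R N (K + K).+1 x).
    lra.
  rewrite !grid_mean_comb !grid_mean_cst -/U -/G -/Q -/Cr; lra.
have [ ] := HC G `|Cr| Q G0 Q0 X.
  move: A1; rewrite ler_norml => /andP[B1 B2].
  have N1 := ler_norm Cr; have N2 : - Cr <= `|Cr| by rewrite -normrN ler_norm.
  have kt := mulr_ge0 k0 t0; have ks := mulr_ge0 k0 s0.
  have F1 := ler_wpM2l kt N1; have F2 := ler_wpM2l ks N2.
  have F3 := ler_wpM2l s0 B2; have F4 := ler_wpM2l ks N1.
  have := ler_wpM2l s0 B1.
  rewrite /a; lra.
move=> GC CrC; move: A1; rewrite ler_norml => /andP[B1 _].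
have N1 := ler_norm Cr; have kC := ler_wpM2l k0 CrC; have kN := ler_wpM2l k0 N1.
have aG := ler_wpM2l (ltW al0) GC.
have kC0 := mulr_ge0 k0 C0; have aC0 := mulr_ge0 (ltW al0) C0.
have kQ := mulr_ge0 kC0 Q0; have aQ := mulr_ge0 aC0 Q0; have CQ := mulr_ge0 C0 Q0.
by split; lra.
Qed.

End Stability.

(** * Gain of integrability *)

Section Bootstrap.
Variables (R : realType) (N : nat).
Implicit Types (u v f g : 'rV[R]_N -> R) (i : 'I_N) (x : 'rV[R]_N) (p theta : R).
Local Notation parab := (@paraboloid R N).

Local Opaque cutoff grid_mean grad_dot laplacian powR partial paraboloid.

(** This is 2 / scale_v, as it must be for the estimate [gain_step] to be
    scale-invariant; it is also p - sigma. *)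
Definition gain p theta : R := (p * theta - 1) / (theta + 1).

(** With q = 2 t - sigma one has 2 t + gain = p + q.  Green for u against
    v^q phi, for v against u v^(q - 1) phi and for phi against u v^q, combined
    with coefficients -1, q and 1, eliminate grad u.  The remaining terms
    contain u v^r with r = q, q - 1 or q - 2, and u v^r is at most a constant
    times v^(sigma + r), which brings them to the three means of
    [energy_estimate]. *)
Lemma gain_step p theta t K : (0 < N)%N -> 1 < p -> p <= theta ->
  t ^+ 2 < Num.sqrt (zpar p theta) * (2 * t - 1) ->
  exists2 C : R, 0 <= C & forall u v, lane_emden p theta u v ->
    linearly_stable p theta u v -> \forall m \near \oo,
    grid_mean m (fun x => v x `^ (2 * t + gain p theta) * cutoff (K + K).+4 x) <=
      C * (1 + grid_mean m (fun x => v x `^ (2 * t) * cutoff (K + K).+2 x)).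
Proof.
move=> N0 p1 pt tz; have [E E0 HE] := @energy_estimate R N p theta t K N0 p1 pt tz.
have t1 : theta + 1 != 0 by rewrite gt_eqF//; lra.
set s := sigma p theta; pose l := (kappa p theta)^-1.
have k0 : 0 < kappa p theta := kappa_gt0 p1 pt.
have l0 : 0 < l by rewrite invr_gt0.
pose q := 2 * t - s; set k : R := (K + K).+4%:R.
have kk0 : 0 <= k by [].
pose c : R := (K + K).+4%:R * (4 * (K + K).+3%:R + 2 * N%:R).
have c0 : 0 <= c by apply: mulr_ge0 => //; apply: addr_ge0; apply: mulr_ge0.
pose A := l * `|q|.
pose B := l * (`|q * (q - 1)| + 2 * `|q| * k).
pose D := l * (2 * `|q| * k + c).
have A0 : 0 <= A by apply: mulr_ge0 => //; exact: ltW.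
have q2 : 0 <= 2 * `|q| * k by apply: mulr_ge0 => //; apply: mulr_ge0.
have B0 : 0 <= B by apply: mulr_ge0; [exact: ltW|exact: addr_ge0].
have D0 : 0 <= D by apply: mulr_ge0; [exact: ltW|exact: addr_ge0].
exists (2 + `|q| + A * E + B * E + D).
  have := mulr_ge0 A0 E0; have := mulr_ge0 B0 E0; have := normr_ge0 q; lra.
move=> u v LE ST; have [[Cu Cv] u0 v0 eu ev] := LE.
have cmp := comparison N0 p1 pt LE.
have Cu1 := C2_C1 Cu; have Cv1 := C2_C1 Cv.
have ul r x : u x * v x `^ r <= l * v x `^ (s + r).
  rewrite powR_add// mulrA; apply: (ler_wpM2r (powR_ge0 _ _)).
  by rewrite /l ler_pdivlMl.
have Cq r : C1 (fun x => v x `^ r) by exact: C1_powR.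
have CP : C1 (cutoff (K + K).+4 : 'rV[R]_N -> R) by exact: C1_cutoff.
have C2P : C2 (cutoff (K + K).+4 : 'rV[R]_N -> R) by exact: C2_cutoff.
pose ga x := v x `^ q * cutoff (K + K).+4 x.
pose gb x := u x * (v x `^ (q - 1) * cutoff (K + K).+4 x).
pose gc x := u x * v x `^ q.
have Ca : C1 ga := C1M (Cq q) CP.
have Cv1P := C1M (Cq (q - 1)) CP; have Cb : C1 gb := C1M Cu1 Cv1P.
have Cc : C1 gc := C1M Cu1 (Cq q).
have Va : vanishes_off_cube ga by exact/vanishes_mulr/cutoff_vanishes.
have Vb : vanishes_off_cube gb by exact/vanishes_mulr/vanishes_mulr/cutoff_vanishes.
have Ha := green Cu Ca (fun i => vanishes_mulr _ Va).
have Hb := green Cv Cb (fun i => vanishes_mulr _ Vb).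
have Hc := green C2P Cc (fun i => vanishes_mull _ (@partial_cutoff_vanishes _ _ _ i)).
apply: filterS2 (filterI Ha (filterI Hb Hc)) (HE u v LE ST) => m [/= ha [hb hc]] [hU hG].
have main : grid_mean m (fun x => v x `^ (2 * t + gain p theta) * cutoff (K + K).+4 x) <=
  grid_mean m (fun x => -1 * (laplacian u x * ga x + grad_dot u ga x) +
    (q * (laplacian v x * gb x + grad_dot v gb x) +
    (1 * (laplacian (cutoff (K + K).+4) x * gc x + grad_dot (cutoff (K + K).+4) gc x) +
    (A * (u x `^ theta * v x `^ (2 * t - 1) * cutoff (K + K).+4 x) +
    (B * (v x `^ (2 * t - 1 - 1) * cutoff (K + K).+4 x * grad_dot v v x) +
    (D * (v x `^ (2 * t) * cutoff (K + K).+2 x) + 0)))))).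
  apply: grid_mean_le => x.
  have -> : laplacian u x = - v x `^ p by rewrite -eu opprK.
  have -> : laplacian v x = - u x `^ theta by rewrite -ev opprK.
  have -> : grad_dot u ga x = v x `^ q * (k * cutoff (K + K).+3 x * grad_dot u parab x) +
      cutoff (K + K).+4 x * (q * v x `^ (q - 1) * grad_dot u v x).
    by rewrite (grad_dotMr _ _ (Cq q) CP) grad_dot_cutoff (grad_dot_powR _ _ _ v0 Cv1).
  have -> : grad_dot v gb x = u x *
    (v x `^ (q - 1) * (k * cutoff (K + K).+3 x * grad_dot v parab x) +
      cutoff (K + K).+4 x * ((q - 1) * v x `^ (q - 1 - 1) * grad_dot v v x)) +
      v x `^ (q - 1) * cutoff (K + K).+4 x * grad_dot u v x.
    by rewrite (grad_dotMr _ _ Cu1 Cv1P) (grad_dotMr _ _ (Cq (q - 1)) CP) grad_dot_cutoff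
      (grad_dot_powR _ _ _ v0 Cv1) (grad_dotC u v).
  have -> : grad_dot (cutoff (K + K).+4) gc x =
      u x * (q * v x `^ (q - 1) * (k * cutoff (K + K).+3 x * grad_dot v parab x)) +
      v x `^ q * (k * cutoff (K + K).+3 x * grad_dot u parab x).
    by rewrite (grad_dotMr _ _ Cu1 (Cq q)) (grad_dot_powR _ _ _ v0 Cv1) (grad_dotC _ u)
      (grad_dotC _ v) !grad_dot_cutoff.
  have -> : v x `^ (2 * t + gain p theta) = v x `^ p * v x `^ q.
    rewrite -powR_add//; congr (_ `^ _); by rewrite /q /s /gain /sigma; field.
  have P0 := cutoff_ge0 (K + K).+4 x; have P2 := cutoff_ge0 (K + K).+2 x.
  have T1 : q * (u x `^ theta * (u x * v x `^ (q - 1)) * cutoff (K + K).+4 x) <=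
      A * (u x `^ theta * v x `^ (2 * t - 1) * cutoff (K + K).+4 x).
    have h := ul (q - 1) x; rewrite (_ : s + (q - 1) = 2 * t - 1) in h; last by rewrite /q; ring.
    have uP := mulr_ge0 (powR_ge0 (u x) theta) P0.
    have n1 := ler_wpM2l (normr_ge0 q) (ler_wpM2l uP h).
    have g0 : 0 <= u x `^ theta * (u x * v x `^ (q - 1)) * cutoff (K + K).+4 x.
      by apply: mulr_ge0 => //; apply: mulr_ge0;
        rewrite ?powR_ge0 ?mulr_ge0 ?powR_ge0 ?(ltW (u0 x)).
    have n2 := ler_wpM2r g0 (ler_norm q).
    by rewrite /A; lra.
  have T2 : - (q * (q - 1) * (u x * v x `^ (q - 1 - 1) * cutoff (K + K).+4 x * grad_dot v v x)) <=
      l * `|q * (q - 1)| * (v x `^ (2 * t - 1 - 1) * cutoff (K + K).+4 x * grad_dot v v x).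
    have h := ul (q - 1 - 1) x; rewrite (_ : s + (q - 1 - 1) = 2 * t - 1 - 1) in h;
      last by rewrite /q; ring.
    have uP := mulr_ge0 P0 (grad_dot_ge0 v x).
    have n1 := ler_wpM2l (normr_ge0 (q * (q - 1))) (ler_wpM2l uP h).
    have g0 : 0 <= u x * v x `^ (q - 1 - 1) * cutoff (K + K).+4 x * grad_dot v v x.
      apply: mulr_ge0; last exact: grad_dot_ge0.
      by apply: mulr_ge0 => //; apply: mulr_ge0; rewrite ?powR_ge0 ?(ltW (u0 x)).
    have n2 := ler_wpM2r g0 (ler_norm (- (q * (q - 1)))); rewrite normrN in n2.
    lra.
  have T3 : - (2 * q * k * (u x * v x `^ (q - 1) * cutoff (K + K).+3 x * grad_dot v parab x)) <=
      l * (2 * `|q| * k) * (v x `^ (2 * t - 1 - 1) * cutoff (K + K).+4 x * grad_dot v v x +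
        v x `^ (2 * t) * cutoff (K + K).+2 x).
    have h := ul (q - 1) x; rewrite (_ : s + (q - 1) = 2 * t - 1) in h; last by rewrite /q; ring.
    have := @cross_young R N v t 1 (K + K) x v0 ltr01.
    rewrite invr1 !mul1r -mulrA normrM (ger0_norm (powR_ge0 _ _)) => y.
    have n1 := ler_wpM2r (normr_ge0 (cutoff (K + K).+3 x * grad_dot v parab x)) h.
    have n2 := ler_wpM2l (ltW l0) y.
    have n3 := ler_wpM2l q2 n1; have n4 := ler_wpM2l q2 n2.
    have X0 : 0 <= u x * v x `^ (q - 1) by apply: mulr_ge0; rewrite ?powR_ge0 ?(ltW (u0 x)).
    clear -X0 kk0 n1 n2 n3 n4; rewrite -[u x * _ * _ * _]mulrA.
    move: (cutoff (K + K).+3 x * _) (u x * _) X0 n1 n2 n3 n4 => y0 X X0 n1 n2 n3 n4.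
    have := ler_norm (- (2 * q * k * (X * y0))).
    rewrite normrN !normrM (ger0_norm kk0) (ger0_norm X0) (ger0_norm (ler0n R 2)); lra.
  have T4 : - (laplacian (cutoff (K + K).+4) x * (u x * v x `^ q)) <=
      l * c * (v x `^ (2 * t) * cutoff (K + K).+2 x).
    have h := ul q x; rewrite (_ : s + q = 2 * t) in h; last by rewrite /q; ring.
    have g0 : 0 <= u x * v x `^ q by apply: mulr_ge0; rewrite ?powR_ge0 ?(ltW (u0 x)).
    have := @laplacian_cutoff_le R N (K + K).+1 x; rewrite -/c ler_norml => /andP[L1 _].
    have n1 := ler_wpM2r g0 L1.
    have n2 := ler_wpM2l (mulr_ge0 c0 P2) h.
    lra.
  rewrite /B /D /ga /gb /gc.
  lra.
move: main; rewrite !grid_mean_comb grid_mean_cst.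
move: ha hb hc; rewrite !ler_norml => /andP[ha _] hb /andP[_ hc].
have hb' : q * grid_mean m (fun x => laplacian v x * gb x + grad_dot v gb x) <= `|q|.
  rewrite (le_trans (ler_norm _))// normrM ler_piMr// ler_norml; exact: hb.
have h1 := ler_wpM2l A0 hU; have h2 := ler_wpM2l B0 hG.
have Q0 : 0 <= grid_mean m (fun x => v x `^ (2 * t) * cutoff (K + K).+2 x).
  rewrite -[leLHS](grid_mean_cst N m); apply: grid_mean_le => x.
  by apply: mulr_ge0; [exact: powR_ge0|exact: cutoff_ge0].
have qQ := mulr_ge0 (normr_ge0 q) Q0.
lra.
Qed.

End Bootstrap.

(** * Bootstrap, exponents and the Liouville theorem *)

Section Moments.
Variables (R : realType) (N : nat).
Implicit Types (u v : 'rV[R]_N -> R) (p theta : R).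
Local Opaque cutoff grid_mean grad_dot laplacian powR partial paraboloid.

(** The constant and the cutoff must not depend on the solution: this is what
    makes the bound applicable to all rescalings at once. *)
Definition bounded_moment p theta (b : R) := exists K (C : R),
  forall u v, lane_emden p theta u v -> linearly_stable p theta u v ->
  \forall m \near \oo, grid_mean m (fun x : 'rV[R]_N => v x `^ b * cutoff K x) <= C.

Lemma bounded_moment_p p theta : 1 < p -> p <= theta -> bounded_moment p theta p.
Proof.
move=> p1 pt; have [K [C H]] := @a_priori R N p theta p1 pt.
by exists K, C => u v LE _; exact: (H u v LE).
Qed.

Lemma bounded_moment_le p theta b b' : 0 <= b' -> b' <= b ->
  bounded_moment p theta b -> bounded_moment p theta b'.
Proof.
move=> b0 bb [K [C H]]; exists K, (C + 1) => u v LE ST.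
have [_ _ v0 _ _] := LE.
apply: filterS (H u v LE ST) => m h.
have : grid_mean m (fun x => v x `^ b' * cutoff K x) <=
       grid_mean m (fun x => 1 * (v x `^ b * cutoff K x) + 1).
  apply: grid_mean_le => x.
  have := powR_le_add1 (v0 x) bb (le_trans b0 bb) b0.
  have c0 := cutoff_ge0 K x; have c1 := cutoff_le1 K x.
  by move=> /(ler_wpM2r c0); lra.
by rewrite grid_mean_comb grid_mean_cst; lra.
Qed.

Lemma bounded_moment_gain p theta t : (0 < N)%N -> 1 < p -> p <= theta ->
  t ^+ 2 < Num.sqrt (zpar p theta) * (2 * t - 1) ->
  bounded_moment p theta (2 * t) -> bounded_moment p theta (2 * t + gain p theta).
Proof.
move=> N0 p1 pt tz [K [C H]].
have [E E0 HE] := @gain_step R N p theta t K N0 p1 pt tz.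
exists (K + K).+4, (E * (1 + C)) => u v LE ST.
apply: filterS2 (H u v LE ST) (HE u v LE ST) => m h1 h2.
apply: (le_trans h2); rewrite ler_wpM2l// lerD2l; apply: le_trans h1.
apply: grid_mean_le => x; rewrite ler_wpM2l ?powR_ge0//.
by apply: cutoff_le; rewrite -addnS -addnS leq_addr.
Qed.

Lemma zpar_gt1 p theta : 1 < p -> p <= theta -> 1 < zpar p theta.
Proof.
move=> p1 pt; rewrite /zpar ltr_pdivlMr; last lra.
rewrite mul1r.
have h1 : 1 * (theta * (p + 1)) < p * (theta * (p + 1)).
  by rewrite ltr_pM2r//; nra.
by nra.
Qed.

Section Roots.
Variables p theta : R.
Hypotheses (p1 : 1 < p) (pt : p <= theta).
Let z := zpar p theta.
Let s := Num.sqrt z.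
Let d := Num.sqrt (z - s).

Lemma sqrt_zpar : [/\ 1 < s, s ^+ 2 = z, 0 < d & d ^+ 2 = z - s].
Proof.
have z1 : 1 < z := zpar_gt1 p1 pt.
have s2 : s ^+ 2 = z by rewrite /s sqr_sqrtr//; lra.
have s0 : 0 <= s := sqrtr_ge0 _.
have s1 : 1 < s by rewrite ltNge; apply/negP => h; nra.
have zs : 0 < z - s by nra.
by split=> //; [rewrite /d sqrtr_gt0|rewrite /d sqr_sqrtr// ltW].
Qed.

(** t0_minus and t0_plus are the roots of t^2 - 2 sqrt z t + sqrt z. *)
Lemma t0_root t : t0_minus p theta < t < t0_plus p theta ->
  t ^+ 2 < Num.sqrt (zpar p theta) * (2 * t - 1).
Proof.
rewrite /t0_minus /t0_plus -/z -/s -/d => /andP[h1 h2].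
by have [_ s2 d0 d2] := sqrt_zpar; nra.
Qed.

Lemma t0_minus_lt_plus : t0_minus p theta < t0_plus p theta.
Proof.
rewrite /t0_minus /t0_plus -/z -/s -/d.
by have [_ _ d0 _] := sqrt_zpar; lra.
Qed.

Lemma t0_minus_gt0 : 0 < t0_minus p theta.
Proof.
rewrite /t0_minus -/z -/s -/d.
by have [s1 s2 d0 d2] := sqrt_zpar; nra.
Qed.

Lemma t0_minus_lt1 : t0_minus p theta < 1.
Proof.
rewrite /t0_minus -/z -/s -/d.
by have [s1 s2 d0 d2] := sqrt_zpar; nra.
Qed.

End Roots.

Lemma gain_gt0 p theta : 1 < p -> p <= theta -> 0 < gain p theta :> R.
Proof. by move=> p1 pt; rewrite /gain divr_gt0//; nra. Qed.

(** Each step raises the exponent by gain.  The exponent 2 t from which a step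
    starts is moved up, if necessary, to some m0 above 2 t0_minus and below
    both p and 2 t0_plus, so that the energy estimate applies and m0 itself is
    covered by the exponent p. *)
Lemma bootstrap p theta : (0 < N)%N -> 1 < p -> p <= theta ->
  2 * t0_minus p theta < p ->
  forall n b, 0 <= b -> b <= p + n%:R * gain p theta ->
    b < 2 * t0_plus p theta + gain p theta -> bounded_moment p theta b.
Proof.
move=> N0 p1 pt tp; have g0 := gain_gt0 p1 pt.
have tm := t0_minus_lt_plus p1 pt; have tm0 := t0_minus_gt0 p1 pt.
elim=> [|n IHn] b b0 bn bt.
  rewrite mul0r addr0 in bn.
  by apply: bounded_moment_le (bounded_moment_p p1 pt).
(* halfway between 2 t0_minus and the smaller of p and 2 t0_plus *)
pose m0 := (2 * t0_minus p theta + Num.min p (2 * t0_plus p theta)) / 2.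
have [m1 m2 m3] : [/\ 2 * t0_minus p theta < m0, m0 < p & m0 < 2 * t0_plus p theta].
  by rewrite /m0; have [h|h] := leP p (2 * t0_plus p theta); split; lra.
pose t := Num.max (b - gain p theta) m0 / 2.
have tE : 2 * t = Num.max (b - gain p theta) m0 by rewrite /t; lra.
have [t1 t2 t3 t4] : [/\ 2 * t0_minus p theta < 2 * t, 2 * t < 2 * t0_plus p theta,
    2 * t <= p + n%:R * gain p theta & b <= 2 * t + gain p theta].
  have gn : 0 <= n%:R * gain p theta by rewrite mulr_ge0// ltW.
  rewrite -[n.+1%:R]natr1 mulrDl mul1r in bn.
  by rewrite tE; have [h|h] := leP (b - gain p theta) m0; split; lra.
apply: (bounded_moment_le b0 t4); apply: bounded_moment_gain => //.
  by apply: t0_root => //; apply/andP; split; lra.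
by apply: IHn => //; lra.
Qed.

Lemma liouville p theta : (0 < N)%N -> 1 < p -> p <= theta ->
  2 * t0_minus p theta < p ->
  N%:R < 2 + 4 * (theta + 1) / (p * theta - 1) * t0_plus p theta ->
  ~ exists u v, lane_emden p theta u v /\ linearly_stable p theta u v.
Proof.
move=> N0 p1 pt tp Nlt [u [v [LE ST]]].
have b0 := scale_v_gt0 p1 pt; have g0 := gain_gt0 p1 pt.
have h : 0 < p * theta - 1 by nra.
have t1 : theta + 1 != 0 by rewrite gt_eqF//; lra.
have gE : scale_v p theta * gain p theta = 2.
  by rewrite /scale_v /gain; field; rewrite t1 gt_eqF.
have bE : 4 * (theta + 1) / (p * theta - 1) = 2 * scale_v p theta.
  by rewrite /scale_v; field; rewrite gt_eqF.
rewrite bE in Nlt.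
set top := 2 * t0_plus p theta + gain p theta.
have Ntop : N%:R < scale_v p theta * top by rewrite /top; lra.
have NB : N%:R / scale_v p theta < top by rewrite ltr_pdivrMr// mulrC.
have NB0 : 0 <= N%:R / scale_v p theta by rewrite divr_ge0// ltW.
pose b := (N%:R / scale_v p theta + top) / 2.
have [b1 b2] : N%:R / scale_v p theta < b /\ b < top by rewrite /b; split; lra.
have [n nP] : exists n, b <= p + n%:R * gain p theta.
  have := truncn_itv (_ : 0 <= b / gain p theta); rewrite divr_ge0 ?(ltW g0)//; last by lra.
  move=> /(_ isT) /andP[_ /ltW bn]; exists (Num.truncn (b / gain p theta)).+1.
  by rewrite ler_pdivrMr// in bn; lra.
have [K [C HC]] : bounded_moment p theta b.
  by apply: (bootstrap N0 p1 pt tp (n := n)) => //; lra.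
have [[_ Cv] u0 v0 _ _] := LE.
apply: (@blowup R N v 0 (scale_v p theta) b C K) => //.
- exact/C1_continuous/C2_C1.
- by move=> x; rewrite ltW.
- by lra.
- by rewrite mulrC -ltr_pdivrMr.
move=> L L1; have L0 : 0 < L by exact: lt_le_trans L1.
exact: HC (lane_emden_rescale 0 p1 pt L0 LE) (linearly_stable_rescale 0 p1 pt L0 u0 v0 ST).
Qed.

(** With y = gain = p - sigma one has z = p (y + 1) > y (y + 1).  If
    t0_plus <= 2 y, squaring twice gives z (4 y - 1)^2 <= 16 y^4, whereas
    y (y + 1) (4 y - 1)^2 - 16 y^4 = y (8 y^2 - 7 y + 1) is positive for
    y >= 1. *)
Lemma t0_plus_gt p theta : 2 <= p -> p <= theta -> 2 * gain p theta < t0_plus p theta.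
Proof.
move=> p2 pt; have p1 : 1 < p by lra.
have [s1 s2 d0 d2] := sqrt_zpar p1 pt.
rewrite /t0_plus; set z := zpar p theta in s1 s2 d0 d2 *.
set s := Num.sqrt z in s1 s2 d0 d2 *; set d := Num.sqrt (z - s) in d0 d2 *.
set y := gain p theta.
have t1 : theta + 1 != 0 by rewrite gt_eqF//; lra.
have sg0 := sigma_gt0 p1 pt; have sg1 := sigma_le1 p1 pt.
have yE : y = p - sigma p theta by rewrite /y /gain /sigma; field.
have zE : z = p * (y + 1) by rewrite yE /z /zpar /sigma; field.
have y1 : 1 <= y by lra.
have zy : y * (y + 1) < z by rewrite zE ltr_pM2r; lra.
rewrite ltNge; apply/negP => sd.
have sd2 : d <= 2 * y - s by lra.
have : 4 * y * s - 4 * y ^+ 2 - s <= 0 by nra.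
move=> h1.
have h2 : s * (4 * y - 1) <= 4 * y ^+ 2 by lra.
have h3 : (s * (4 * y - 1)) ^+ 2 <= (4 * y ^+ 2) ^+ 2.
  by rewrite lerXn2r// nnegrE; nra.
rewrite exprMn s2 in h3.
have y4 : 0 < (4 * y - 1) ^+ 2 by rewrite exprn_gt0//; lra.
have h4 : y * (y + 1) * (4 * y - 1) ^+ 2 < (4 * y ^+ 2) ^+ 2.
  by apply: lt_le_trans h3; rewrite ltr_pM2r.
have h5 : 0 < y * (8 * y ^+ 2 - 7 * y + 1) by rewrite mulr_gt0//; nra.
lra.
Qed.

Lemma solution_lane_emden p theta u v : positive_solution p theta u v ->
  lane_emden p theta u v.
Proof. by move=> [[su sv] u0 v0 eu ev]; split=> //; split; exact: smooth_C2. Qed.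

Lemma stable_linearly_stable p theta u v : stable p theta u v ->
  linearly_stable p theta u v.
Proof.
move=> [zeta [chi [[sz sc] z0 c0 ez ec]]]; exists zeta, chi.
by split=> //; split; exact: smooth_C2.
Qed.

End Moments.

Theorem theorem1 (R : realType) (N : nat) (hN : (1 <= N)%N) :
  ((forall p theta : R, 2 <= p -> p <= theta ->
      N%:R < 2 + 4 * (theta + 1) / (p * theta - 1) * t0_plus p theta ->
      ~ exists u v : 'rV[R]_N -> R,
          positive_solution p theta u v /\ stable p theta u v)
   /\
   ((N <= 10)%N -> forall p theta : R, 2 <= p -> p <= theta ->
      ~ exists u v : 'rV[R]_N -> R,
          positive_solution p theta u v /\ stable p theta u v))
  /\
  (forall p theta : R, 1 < p -> p <= theta ->
     2 * t0_minus p theta < p ->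
     N%:R < 2 + 4 * (theta + 1) / (p * theta - 1) * t0_plus p theta ->
     ~ exists u v : 'rV[R]_N -> R,
         positive_solution p theta u v /\ stable p theta u v).
Proof.
have part2 (p theta : R) : 1 < p -> p <= theta -> 2 * t0_minus p theta < p ->
    N%:R < 2 + 4 * (theta + 1) / (p * theta - 1) * t0_plus p theta ->
    ~ exists u v : 'rV[R]_N -> R,
      positive_solution p theta u v /\ stable p theta u v.
  move=> p1 pt tp NL [u [v [US ST]]]; apply: (liouville hN p1 pt tp NL).
  by exists u, v; split; [exact: solution_lane_emden|exact: stable_linearly_stable].
have part1 (p theta : R) : 2 <= p -> p <= theta ->
    N%:R < 2 + 4 * (theta + 1) / (p * theta - 1) * t0_plus p theta ->
    ~ exists u v : 'rV[R]_N -> R,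
      positive_solution p theta u v /\ stable p theta u v.
  move=> p2 pt; have p1 : 1 < p by lra.
  by apply: part2 => //; have := t0_minus_lt1 p1 pt; lra.
split=> //; split=> // N10 p theta p2 pt; apply: part1 => //.
have p1 : 1 < p by lra.
have := t0_plus_gt p2 pt; have := scale_v_gt0 p1 pt.
have gE : scale_v p theta * gain p theta = 2.
  rewrite /scale_v /gain; field.
  by apply/andP; split; rewrite gt_eqF//; nra.
have -> : 4 * (theta + 1) / (p * theta - 1) = 2 * scale_v p theta.
  by rewrite /scale_v; field; rewrite gt_eqF//; nra.
move=> b0; rewrite -(ltr_pM2l b0) => h.
have : N%:R <= 10 :> R by rewrite ler_nat.
lra.
Qed.
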